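(* Let $\mathcal H$ be a complex Hilbert space and $d\in\mathbb N$. If $\mathsf T\in\mathcal B(\mathcal H)^d$ is a $d$-tuple of pairwise commuting operators, then $$r(\mathsf T)\le\omega(\mathsf T)\le\rho(\mathsf T).$$ If $\mathsf N\in\mathcal B(\mathcal H)^d$ is a normal $d$-tuple, then $$r_G(\mathsf N)=r(\mathsf N)=\omega(\mathsf N)=\rho(\mathsf N).$$
   Context: $\mathcal B(\mathcal H)$ is the algebra of bounded operators on the Hilbert space $\mathcal H$. Let $\mathsf T=(T_1,\dots,T_d)\in\mathcal B(\mathcal H)^d$ and $\alpha\in\mathbb R_+=[0,\infty)$. Positive means positive semidefinite. Let $\mathcal T_\alpha$ be the $(d+1)\times(d+1)$ Toeplitz operator matrix on $\bigoplus_1^{d+1}\mathcal H$ whose $(i,j)$ entry is $\alpha 1_{\mathcal H}$ if $i=j$, $T_{i-j}$ if $i>j$, and $T_{j-i}^*$ if $i<j$. The Toeplitz modulus is $\rho(\mathsf T)=\inf\{\alpha\in\mathbb R_+ : \mathcal T_\alpha\text{ is positive}\}$. For $\xi\in\mathcal H$, let $\mathcal T_{\alpha,\xi}$ be the $(d+1)\times(d+1)$ complex Toeplitz matrix whose $(i,j)$ entry is $\alpha$ if $i=j$, $\langle T_{i-j}\xi,\xi\rangle$ if $i>j$, and $\langle T_{j-i}^*\xi,\xi\rangle$ if $i<j$. The Toeplitz numerical radius is $\omega(\mathsf T)=\inf\{\alpha\in\mathbb R_+ : \mathcal T_{\alpha,\xi}\text{ is positive for every unit vector }\xi\in\mathcal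 H\}$. A $d$-tuple is normal if its entries are commuting normal operators. For a pairwise commuting $d$-tuple $\mathsf T$, the Taylor joint spectrum $\mathrm{Sp}_T(\mathsf T)\subset\mathbb C^d$ is the set of $\lambda\in\mathbb C^d$ for which the Koszul complex $E(\mathsf T-\lambda,\mathcal H)$ of $(T_1-\lambda_1 1_{\mathcal H},\dots,T_d-\lambda_d1_{\mathcal H})$ on $\mathcal H$ is not exact. For a normal $d$-tuple $\mathsf N=(N_1,\dots,N_d)$, the Gelfand joint spectrum $\mathrm{Sp}_G(\mathsf N)$ is the set of $\lambda\in\mathbb C^d$ for which there is a unital homomorphism $\pi:\mathrm C^*(\mathsf N)\to\mathbb C$ with $\lambda_j=\pi(N_j)$ for all $j$, where $\mathrm C^*(\mathsf N)$ is the unital abelian C$^*$-algebra generated by $N_1,\dots,N_d$. For $\lambda\in\mathbb C^d$, let $\Lambda_{\alpha,\lambda}$ be the $(d+1)\times(d+1)$ Toeplitz matrix whose $(i,j)$ entry is $\alpha$ if $i=j$, $\lambda_{i-j}$ if $i>j$, and $\overline{\lambda_{j-i}}$ if $i<j$. The Toeplitz spectral radius of a commuting $d$-tuple is $r(\mathsf T)=\inf\{\alpha\in\mathbb R_+:\Lambda_{\alpha,\lambda}\text{ is positive for every }\lambda\in\mathrm{Sp}_T(\mathsf T)\}$. The Gelfand-Toeplitz spectral radius of a normal $d$-tuple is $r_G(\mathsf N)=\inf\{\alpha\in\mathbb R_+:\Lambda_{\alpha,\lambda}\text{ is positive for every }\lambda\in\mathrm{Sp}_G(\mathsf N)\}$.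 *)

(* Defs.v *)
From HB Require Import structures.
From mathcomp Require Import all_boot all_order all_algebra.
From mathcomp Require Import complex.
From mathcomp Require Import boolp classical_sets functions reals topology.
From mathcomp Require Import normedtype.

Set Implicit Arguments.
Unset Strict Implicit.
Unset Printing Implicit Defensive.

Import Order.TTheory GRing.Theory Num.Theory Num.Def.
Import numFieldNormedType.Exports.

Local Open Scope classical_set_scope.
Local Open Scope complex_scope.
Local Open Scope ring_scope.
Local Open Scope sesquilinear_scope.

(* {dot H for conjC} is the type of positive definite Hermitian forms on H,
   linear in the first argument and conjugate-linear in the second. *)
HB.mixin Record isHilbert (R : realType) H of CompleteNormedModule R[i] H := {
  hdot : {dot H for (@conjC R[i])};
  hdotE : forall x : H, `|x| ^+ 2 = hdot x x }.

#[short(type="hilbertType")]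
HB.structure Definition Hilbert (R : realType) :=
  {H of isHilbert R H & CompleteNormedModule R[i] H}.

Section Operators.
Context {R : realType} {H : hilbertType R}.
Local Notation C := R[i].

(* Operators are plain functions, with the pointwise linear structure of
   H -> H; the algebra B(H) is a set of such functions. *)
Definition bounded_op : set (H -> H) :=
  [set A | linear A /\ exists M : R, forall x, `|A x| <= M%:C * `|x|].

(* For A in B(H), the vector z below exists by the Riesz representation
   theorem, and it is unique because the form is definite. *)
Definition adj (A : H -> H) : H -> H :=
  fun y => xget 0 [set z | forall x, hdot (A x) y = hdot x z].

Definition commuting d (T : d.-tuple (H -> H)) :=
  forall i j, tnth T i \o tnth T j = tnth T j \o tnth T i.

Definition normal_op (A : H -> H) := A \o adj A = adj A \o A.

Definition normal_tuple d (N : d.-tuple (H -> H)) :=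
  commuting N /\ forall i, normal_op (tnth N i).

(* 0 <= z in C means that z is real and nonnegative. The sum is the inner
   product of A x and x in the n-fold Hilbert space direct sum of H. *)
Definition positive_opmx n (A : 'M[H -> H]_n) :=
  forall x : 'I_n -> H, 0 <= \sum_i hdot (\sum_j A i j (x j)) (x i).

End Operators.

Definition psdmx (R : realType) n (A : 'M[R[i]]_n) :=
  forall v : 'cV[R[i]]_n, 0 <= (v ^t conjC *m A *m v) 0 0.

(* The k-th entry of a tuple is numbered from 1 in the mathematics and from 0
   here, whence the predecessors; the default value of the sequence access is
   never reached, since the differences range over 1, ..., d. *)
Definition toeplitz (E : nmodType) d (a : E) (low upp : d.-tuple E) :
    'M[E]_d.+1 :=
  \matrix_(i, j) if (j < i)%N then low`_(i - j).-1
                 else if (i < j)%N then upp`_(j - i).-1 else a.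

Section Radii.
Context {R : realType} {H : hilbertType R} {d : nat}.
Local Notation C := R[i].
Implicit Types (T N : d.-tuple (H -> H)) (lam : d.-tuple C) (a : R).

Definition toeplitz_op a T : 'M[H -> H]_d.+1 :=
  toeplitz (a%:C *: (idfun : H -> H)) T (map_tuple adj T).

Definition toeplitz_vec a T (xi : H) : 'M[C]_d.+1 :=
  toeplitz a%:C (map_tuple (fun A => hdot (A xi) xi) T)
                (map_tuple (fun A => hdot (adj A xi) xi) T).

Definition toeplitz_pt a lam : 'M[C]_d.+1 :=
  toeplitz a%:C lam (map_tuple conjC lam).

Definition toeplitz_modulus T : R :=
  inf [set a : R | 0 <= a /\ positive_opmx (toeplitz_op a T)].

Definition toeplitz_num_radius T : R :=
  inf [set a : R | 0 <= a /\
         forall xi : H, `|xi| = 1 -> psdmx (toeplitz_vec a T xi)].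

(* The Koszul complex on the exterior algebra of C^d tensored with H: an
   element xi stands for the sum over S of xi S (x) e_S, where e_S is the
   wedge of the basis vectors indexed by S in increasing order. *)
Definition koszul_chain (p : nat) : set {ffun {set 'I_d} -> H} :=
  [set xi | forall S : {set 'I_d}, #|S| != p -> xi S = 0].

(* The boundary of x (x) e_{j_1} /\ ... /\ e_{j_p} is the sum over k of
   (-1)^(k-1) T_{j_k} x (x) e_{j_1} /\ .. (omit e_{j_k}) .. /\ e_{j_p}; its
   coefficient at e_S collects the terms with {j_1, ..., j_p} = j |: S. *)
Definition koszul_bd T (xi : {ffun {set 'I_d} -> H}) : {ffun {set 'I_d} -> H} :=
  [ffun S : {set 'I_d} => \sum_(j | j \notin S)
     ((-1) ^+ #|[set i in S | (i < j)%N]| : C) *: tnth T j (xi (j |: S)%SET)].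

Definition koszul_exact T :=
  forall p, [set xi | koszul_chain p xi /\ koszul_bd T xi = 0]
            = koszul_bd T @` koszul_chain p.+1.

Definition tuple_shift T lam : d.-tuple (H -> H) :=
  [tuple tnth T j - tnth lam j *: (idfun : H -> H) | j < d].

Definition taylor_spectrum T : set (d.-tuple C) :=
  [set lam | ~ koszul_exact (tuple_shift T lam)].

Definition toeplitz_spectral_radius T : R :=
  inf [set a : R | 0 <= a /\
         forall lam, taylor_spectrum T lam -> psdmx (toeplitz_pt a lam)].

(* The last clause is closedness in the operator norm. *)
Definition unital_cstar_subalgebra (A : set (H -> H)) :=
  [/\ A `<=` bounded_op, A idfun,
      forall (c : C) f g, A f -> A g -> A (c *: f + g),
      forall f g, A f -> A g -> A (f \o g) /\ A (adj f) &
      forall f, bounded_op f ->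
        (forall e : R, 0 < e ->
           exists2 g, A g & forall x, `|f x - g x| <= e%:C * `|x|) ->
        A f].

Definition cstar_generated N : set (H -> H) :=
  smallest unital_cstar_subalgebra (range (tnth N)).

(* Only the values of pi on A matter. *)
Definition unital_hom_on (A : set (H -> H)) (pi : (H -> H) -> C) :=
  [/\ pi idfun = 1,
      forall (c : C) f g, A f -> A g -> pi (c *: f + g) = c * pi f + pi g &
      forall f g, A f -> A g -> pi (f \o g) = pi f * pi g].

Definition gelfand_spectrum N : set (d.-tuple C) :=
  [set lam | exists2 pi, unital_hom_on (cstar_generated N) pi &
               forall j, tnth lam j = pi (tnth N j)].

Definition gelfand_toeplitz_radius N : R :=
  inf [set a : R | 0 <= a /\
         forall lam, gelfand_spectrum N lam -> psdmx (toeplitz_pt a lam)].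

End Radii.

(* Main.v *)
(** Write [S_rho], [S_omega], [S_r], [S_G] for the sets of admissible [alpha] in
    the four infima, and [<=] for inclusion. Testing [T_alpha] on vectors
    [(v_i xi)_i] gives [S_rho <= S_omega]. If [v] witnesses that
    [Lambda_{alpha, lam}] is not positive while all [T_{alpha, xi}] are, then
    [sum_k c_k (T_k - lam_k)], with [c] the autocorrelation of [v], is coercive,
    hence invertible, and this contracts the Koszul complex of [T - lam]:
    [S_omega <= S_r].

    For a normal tuple, if the Koszul complex of [N - lam] is exact then
    [sum_j (N_j - lam_j) (N_j - lam_j)^*] is coercive by uniform boundedness, so
    invertible in [C^*(N)], and no character can send it to [0]. This gives
    [Sp_G <= Sp_T], hence [S_r <= S_G]. Finally let [T_alpha] be non-positive. By
    Fuglede's theorem it commutes with the real and imaginary parts of the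
    [N_j], so there are joint approximate eigenvectors [X], with a negative
    approximate eigenvalue for [T_alpha] and approximate eigenvalues [mu] for
    [N]. The point [mu] is in [Sp_G], and pairing the components of [X] with the
    largest one gives a vector on which [Lambda_{alpha, mu}] is negative:
    [S_G <= S_rho]. *)

Require Import Defs.
From mathcomp Require Import all_boot all_order all_algebra.
From mathcomp Require Import zify ring lra.
From mathcomp Require Import complex.
From mathcomp Require Import boolp classical_sets functions reals topology.
From mathcomp Require Import normedtype sequences.

Set Implicit Arguments.
Unset Strict Implicit.
Unset Printing Implicit Defensive.

Import Order.TTheory GRing.Theory Num.Theory Num.Def.
Import numFieldNormedType.Exports.

Local Open Scope classical_set_scope.
Local Open Scope complex_scope.
Local Open Scope ring_scope.

(** The inclusions close into a cycle, which turns them into equalities. Everything spectral is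
    extracted from real quadratic forms: the inner product is replaced by its real part, approximate
    eigenvalues are suprema of lower bounds, and inverses come from minimizing a quadratic
    functional.

    In the normal case the sign of T_alpha and the point mu must be seen at the same vector. Hence
    T_alpha itself belongs to the commuting family, in first place, where the eigenvalue produced is
    the bottom of the form. The character at mu sends f to the scalar by which f acts on all
    sufficiently good joint approximate eigenvectors; this relation survives the algebraic
    operations and norm limits.

    A joint eigenvector X has components in H, whereas Lambda acts on scalars. The functional y ->
    <y, X_i0> carries one to the other. Choosing a large component X_i0 keeps <X_i0, X_i0>
    comparable with |X|^2, so the approximation errors cannot swamp the negative term. *)

Local Notation Re := complex.Re.
Local Notation Im := complex.Im.

(** * Real positive semidefinite forms *)

Section SymmetricForms.
Context {R : realType} {V : lmodType R[i]}.
Implicit Types (b q : V -> V -> R) (A : V -> V) (x y z : V).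

(** Real bilinear forms on a complex space, real scalars acting through [%:C]. They may be
    degenerate, as the defect forms [q] used below are. *)
Definition sform b :=
  [/\ forall x y, b x y = b y x, forall x y z, b (x + y) z = b x z + b y z,
      forall (r : R) x y, b (r%:C *: x) y = r * b x y & forall x, 0 <= b x x].

Definition rlinear A :=
  (forall x y, A (x + y) = A x + A y) /\
  (forall (r : R) x, A (r%:C *: x) = r%:C *: A x).

Lemma sformC b : sform b -> forall x y, b x y = b y x.
Proof. by case. Qed.
Lemma sformDl b : sform b -> forall x y z, b (x + y) z = b x z + b y z.
Proof. by case. Qed.
Lemma sformDr b : sform b -> forall x y z, b x (y + z) = b x y + b x z.
Proof. by move=> hb x y z; rewrite sformC// sformDl// !(sformC hb x). Qed.
Lemma sformZl b : sform b -> forall r x y, b (r%:C *: x) y = r * b x y.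
Proof. by case. Qed.
Lemma sformZr b : sform b -> forall r x y, b x (r%:C *: y) = r * b x y.
Proof. by move=> hb r x y; rewrite sformC// sformZl// (sformC hb x). Qed.
Lemma sform_ge0 b : sform b -> forall x, 0 <= b x x.
Proof. by case. Qed.

Lemma scaleN1C x : (- 1)%:C *: x = - x.
Proof. by rewrite (rmorphN (real_complex R)) rmorph1 scaleN1r. Qed.

Lemma sformNl b : sform b -> forall x y, b (- x) y = - b x y.
Proof. by move=> hb x y; rewrite -scaleN1C sformZl// mulN1r. Qed.
Lemma sformNr b : sform b -> forall x y, b x (- y) = - b x y.
Proof. by move=> hb x y; rewrite -scaleN1C sformZr// mulN1r. Qed.

Definition sformE b (hb : sform b) :=
  (sformDl hb, sformDr hb, sformNl hb, sformNr hb, sformZl hb, sformZr hb).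

Lemma rlinearD A x y : rlinear A -> A (x + y) = A x + A y.
Proof. by case. Qed.
Lemma rlinearZ A r x : rlinear A -> A (r%:C *: x) = r%:C *: A x.
Proof. by case. Qed.
Lemma rlinearN A x : rlinear A -> A (- x) = - A x.
Proof. by move=> hA; rewrite -!scaleN1C rlinearZ. Qed.

Lemma sform_amgm b : sform b -> forall w x y, 0 < w ->
  b x y * 2 <= w * b x x + w^-1 * b y y.
Proof.
move=> hb w x y w0; have := sform_ge0 hb (w%:C *: x - y).
rewrite !sformE// (sformC hb y x) => h.
have : 0 <= w^-1 * (w * (w * b x x) - w * b x y - (w * b x y - b y y)).
  by apply: mulr_ge0; [rewrite invr_ge0 ltW | lra].
suff -> : w^-1 * (w * (w * b x x) - w * b x y - (w * b x y - b y y)) =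
  w * b x x - b x y * 2 + w^-1 * b y y by lra.
by field; rewrite gt_eqF.
Qed.

Lemma sform_amgm1 b : sform b -> forall x y, b x y * 2 <= b x x + b y y.
Proof.
move=> hb x y; have := sform_amgm hb x y (@ltr01 R).
by rewrite invr1 !mul1r.
Qed.

Lemma sform_amgm1N b : sform b -> forall x y, - (b x x + b y y) <= b x y * 2.
Proof.
move=> hb x y; have := sform_amgm1 hb (- x) y; rewrite !sformE// => h; lra.
Qed.

(** The polynomial in [t] of [key] is nonnegative. When [b y y = 0] it is affine, and a nonzero
    slope would let it reach [-1]; otherwise it is evaluated at its minimum. *)
Lemma sform_cauchy b : sform b -> forall x y, b x y ^+ 2 <= b x x * b y y.
Proof.
move=> hb x y; have bx := sform_ge0 hb x; have by0 := sform_ge0 hb y.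
have key (t : R) : 0 <= b x x + 2 * t * b x y + t ^+ 2 * b y y.
  have := sform_ge0 hb (x + t%:C *: y); rewrite !sformE// (sformC hb y x).
  by move=> h; lra.
have [b0|bn0] := eqVneq (b y y) 0.
  suff -> : b x y = 0 by rewrite b0 expr0n mulr0.
  apply/eqP; apply: contraT => bxy.
  have := key (- (b x x + 1) / (2 * b x y)); rewrite b0 mulr0 addr0.
  suff -> : b x x + 2 * (- (b x x + 1) / (2 * b x y)) * b x y = -1 by lra.
  by field.
have by1 : 0 < b y y by rewrite lt_def bn0.
have := key (- b x y / b y y) => h.
have : 0 <= b y y * (b x x + 2 * (- b x y / b y y) * b x y
                     + (- b x y / b y y) ^+ 2 * b y y) by apply: mulr_ge0.
suff -> : b y y * (b x x + 2 * (- b x y / b y y) * b x y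
                     + (- b x y / b y y) ^+ 2 * b y y)
   = b x x * b y y - b x y ^+ 2 by lra.
by field.
Qed.

End SymmetricForms.


(** * Joint approximate eigenvectors of commuting symmetric operators *)

Section JointApproximateEigenvectors.
Context {R : realType} {V : lmodType R[i]}.
Variable ip : V -> V -> R.
Hypothesis ip_sform : sform ip.
Implicit Types (q : V -> V -> R) (A : V -> V) (x y z : V).

Let ipE := sformE ip_sform.
Let ipC := sformC ip_sform.
Let ip_ge0 := sform_ge0 ip_sform.

Definition symmetric_op A :=
  [/\ rlinear A, forall x y, ip (A x) y = ip x (A y) &
      exists2 K : R, 0 <= K & forall x, ip (A x) (A x) <= K * ip x x].

(** For a positive form: its Rayleigh quotient has infimum 0, the approximate version of a nonzero
    null vector. *)
Definition infimum0 q := forall e : R, 0 < e ->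
  exists2 x, 0 < ip x x & q x x <= e * ip x x.

(* [a] is the supremum over [n] of the lower bounds of [A + n q]; the
   commutation of [A] and [q] keeps [n q] small along a minimizing sequence. *)
Lemma approx_eigen_step q A K : sform q -> rlinear A -> 0 <= K ->
    (forall x y, ip (A x) y = ip x (A y)) ->
    (forall x, ip (A x) (A x) <= K * ip x x) ->
    (forall x y, q (A x) y = q x (A y)) ->
    (forall x, q (A x) (A x) <= K * q x x) -> infimum0 q ->
  exists2 a : R, (forall x, q x x = 0 -> a * ip x x <= ip (A x) x) &
    infimum0 (fun x y => q x y + ip (A x - a%:C *: x) (A y - a%:C *: y)).
Proof.
move=> hq hA K0 Aip AK qA qK q0.
have q_ge0 := sform_ge0 hq.
pose f (n : nat) x := ip (A x) x + n%:R * q x x.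
pose S := [set m : R | exists n : nat, forall x, m * ip x x <= f n x].
have f_mono n m x : (n <= m)%N -> f n x <= f m x.
  by move=> nm; rewrite lerD2l ler_wpM2r// ler_nat.
have lowA x : - (K + 1) * ip x x <= ip (A x) x * 2.
  have := sform_amgm1N ip_sform (A x) x; have := AK x; lra.
have uppA x : ip (A x) x * 2 <= (K + 1) * ip x x.
  have := sform_amgm1 ip_sform (A x) x; have := AK x; lra.
have S0 : S !=set0.
  exists (- (K + 1)); exists 0%N => x; rewrite /f mul0r addr0.
  have := lowA x; have := ip_ge0 x; nra.
have Sub : has_sup S.
  split=> //; exists (K + 2) => m [n hm].
  have [|x x0 qx] := q0 (n.+1%:R^-1); first by rewrite invr_gt0 ltr0Sn.
  have nq : n%:R * q x x <= ip x x.
    have nS : (0 : R) < n.+1%:R by rewrite ltr0Sn.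
    rewrite mulrC ler_pdivlMr// in qx.
    by rewrite mulrC; apply: le_trans qx; rewrite ler_wpM2l// ler_nat.
  have := hm x; rewrite /f => h; have := uppA x => h2.
  rewrite -(ler_pM2r x0); nra.
pose a := sup S.
have aS n x : q x x = 0 -> a * ip x x <= f n x.
  move=> qx; have [ix|ix] := eqVneq (ip x x) 0.
    have := lowA x; rewrite ix /f qx; lra.
  have ix0 : 0 < ip x x by rewrite lt_def ix ip_ge0.
  rewrite -ler_pdivlMr//; apply: ge_sup => // m [k /(_ x)].
  by rewrite ler_pdivlMr// /f qx !mulr0.
exists a.
  by move=> x qx; have := aS 0%N x qx; rewrite /f mul0r addr0.
(* [C1] dominates the operator part of [B y y], [C2] the growth of [q] from [x] to [y], and [Ct]
   collects the final bound, so that [h * Ct <= e] concludes. *)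
pose C1 := (K + 1) + `|a| + 1.
pose C2 := K + a ^+ 2.
have C1_ge1 : 1 <= C1 by rewrite /C1; have := normr_ge0 a; lra.
have C20 : 0 <= C2 by rewrite /C2; have := sqr_ge0 a; lra.
have aN1 : a <= `|a| by rewrite ler_norm.
have aN2 : - `|a| <= a by rewrite lerNl -normrN ler_norm.
pose Ct := 2 + 2 * (C1 * 2 + 2 * C2 + 1 / 2 + 4 * ((1 + K) / 2 + `|a|)).
have Ct2 : 2 <= Ct by rewrite /Ct; have := normr_ge0 a; lra.
move=> e e0; pose h := minr (1 / 2) (e / Ct).
have h0 : 0 < h by rewrite lt_min; apply/andP; split; [lra | rewrite divr_gt0//; lra].
have hh : h <= 1 / 2 by rewrite ge_min lexx.
have he : h * Ct <= e.
  by rewrite -ler_pdivlMr; [rewrite ge_min lexx orbT | lra].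
have [m0 [n0 hn0] /ltW am] := sup_adherent h0 Sub.
pose n := n0.+1.
have hn x : (a - h) * ip x x <= f n x.
  apply: le_trans (f_mono n0 n x (leqnSn _)); apply: le_trans (hn0 x).
  by apply: ler_wpM2r.
(* [a + h] exceeds the supremum, so it fails as a lower bound for every [n]. It is refuted at
   [n.*2]: comparison with the lower bound at [n] then leaves [n * q x x <= 2 * h * s], so the
   penalty is small at [x]. *)
have [x hx] : exists x, f n.*2 x < (a + h) * ip x x.
  apply: contrapT => /forallNP hx.
  have : (a + h) <= a.
    apply: (ub_le_sup (proj2 Sub)); exists n.*2 => x.
    by rewrite leNgt; apply/negP/hx.
  lra.
have n2 : n.*2%:R = n%:R + n%:R :> R by rewrite -addnn natrD.
have hn2 := hn x; set s := ip x x in hx hn2 *.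
have n1 : (1 : R) <= n%:R by rewrite ler1n.
have nq : n%:R * q x x <= 2 * h * s.
  by move: hx hn2; rewrite /f n2; lra.
have qx0 := q_ge0 x.
have s0 : 0 < s.
  rewrite lt_def ip_ge0 andbT; apply/eqP => s0.
  move: hx hn2; rewrite /f n2 s0; nra.
exists x => //; rewrite -/s.
set y := A x - a%:C *: x.
(* [B] is positive because [a - h] is still a lower bound at [n.*2], while [B x x] is of order [h].
   So [x] is almost in the kernel of [B], which makes [B x y] small; and [B x y] is [ip y y] up to
   small terms. *)
pose B u v := ip (A u) v + n.*2%:R * q u v - (a - h) * ip u v.
have B_sform : sform B.
  split=> [u v|u v w|r u v|u]; rewrite /B.
  - by rewrite Aip (ipC u) (sformC hq u) (ipC u).
  - by rewrite rlinearD// !(ipE, sformDl hq); ring.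
  - by rewrite rlinearZ// !(ipE, sformZl hq); ring.
  - have := hn u; have := f_mono n n.*2 u; rewrite -addnn leq_addr => /(_ isT).
    by rewrite /f; lra.
have Bx : B x x <= 2 * h * s by move: hx; rewrite /f /B -/s; lra.
have qy : q y y <= 2 * C2 * q x x.
  have := sform_ge0 hq (A x + a%:C *: x); rewrite /y !(sformE hq) /C2.
  have := qK x; have := q_ge0 (A x); nra.
have t0 : (0 : R) <= n.*2%:R by [].
have tq : n.*2%:R * q x x <= 4 * h * s by rewrite n2; lra.
have tqy : n.*2%:R * q y y <= 8 * C2 * h * s.
  apply: le_trans (ler_wpM2l t0 qy) _.
  have : 2 * C2 * (n.*2%:R * q x x) <= 2 * C2 * (4 * h * s).
    by apply: ler_wpM2l => //; lra.
  lra.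
have y0 := ip_ge0 y.
have By : B y y <= C1 * ip y y + 8 * C2 * h * s.
  have := uppA y; rewrite /B /C1; nra.
have Bxy : B x y = ip y y + h * ip x y + n.*2%:R * q x (A x)
                   - n.*2%:R * a * q x x.
  have -> : B x y = ip y y + h * ip x y + n.*2%:R * q x y.
    by rewrite /B {2}/y !ipE; ring.
  rewrite {3}/y !(sformE hq); ring.
have C10 : 0 < 2 * C1 by lra.
have BB := sform_amgm B_sform x y C10.
have BB2 : (2 * C1)^-1 * B y y <= ip y y / 2 + 4 * C2 * h * s.
  rewrite ler_pdivrMl//.
  have : 0 <= 8 * C2 * h * s * (C1 - 1).
    by apply: mulr_ge0; [rewrite !mulr_ge0// ltW | lra].
  by lra.
have BB1 : 2 * C1 * B x x <= 2 * C1 * (2 * h * s) by apply: ler_wpM2l => //; lra.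
have hxy : - (h * (s + ip y y)) <= h * ip x y * 2.
  have := sform_amgm1N ip_sform x y; rewrite -/s => hs.
  by have := ler_wpM2l (ltW h0) hs; lra.
have qxA : - ((1 + K) * q x x) <= q x (A x) * 2.
  by have := sform_amgm1N hq x (A x); have := qK x; lra.
have tqxA : - ((1 + K) * (4 * h * s)) <= n.*2%:R * q x (A x) * 2.
  have h1 := ler_wpM2l t0 qxA.
  have K1 : 0 <= 1 + K by lra.
  by have := ler_wpM2l K1 tq; lra.
have taq : n.*2%:R * a * q x x <= `|a| * (4 * h * s).
  have := ler_wpM2l (normr_ge0 a) tq.
  have := ler_wpM2r (mulr_ge0 t0 qx0) aN1; lra.
have hy : h * ip y y <= 1 / 2 * ip y y by apply: ler_wpM2r.
have qs : q x x <= 2 * h * s.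
  by have := ler_wpM2r qx0 n1; lra.
have -> : q x x + ip y y = q x x + (ip y y / 4 + 3 / 4 * ip y y) by field.
suff : ip y y / 2 <=
  (C1 * 2 + 2 * C2 + 1 / 2 + 4 * ((1 + K) / 2 + `|a|)) * h * s.
  have := ler_wpM2r (ltW s0) he; rewrite /Ct; lra.
lra.
Qed.

(** Induction on [n]: the defects of the first [n] operators make up a form [q] with infimum 0,
    compatible with [A n] by commutation, and [approx_eigen_step] adds one eigenvalue. At the first
    step [q] vanishes identically, so the eigenvalue of [A 0] bounds its whole quadratic form from
    below. *)
Lemma joint_approx_eigen (A : nat -> V -> V) :
    (forall k, symmetric_op (A k)) ->
    (forall j k x, A j (A k x) = A k (A j x)) -> (exists x, 0 < ip x x) ->
  forall n, exists2 a : nat -> R,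
    ((0 < n)%N -> forall x, a 0 * ip x x <= ip (A 0 x) x) &
    infimum0 (fun x y => \sum_(k < n)
      ip (A k x - (a k)%:C *: x) (A k y - (a k)%:C *: y)).
Proof.
move=> hA AC [x0 ipx0]; elim=> [|n [a a0 an]].
  by exists (fun=> 0) => // e e0; exists x0 => //; rewrite big_ord0 mulr_ge0// ltW.
pose D k x := A k x - (a k)%:C *: x.
pose q x y := \sum_(k < n) ip (D k x) (D k y).
have DD k x y : D k (x + y) = D k x + D k y.
  have [lA _ _] := hA k.
  by rewrite /D (rlinearD _ _ lA) scalerDr opprD addrACA.
have DZ k (r : R) x : D k (r%:C *: x) = r%:C *: D k x.
  have [lA _ _] := hA k.
  rewrite /D (rlinearZ _ _ lA) scalerBr.
  by congr (_ - _); rewrite !scalerA mulrC.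
have DA k x : D k (A n x) = A n (D k x).
  have [lA _ _] := hA n.
  by rewrite /D (rlinearD _ _ lA) (rlinearN _ lA) (rlinearZ _ _ lA) AC.
have hq : sform q.
  split=> [x y|x y z|r x y|x]; rewrite /q.
  - by apply: eq_bigr => k _; rewrite ipC.
  - by rewrite -big_split/=; apply: eq_bigr => k _; rewrite DD (sformDl ip_sform).
  - by rewrite mulr_sumr; apply: eq_bigr => k _; rewrite DZ (sformZl ip_sform).
  - by apply: sumr_ge0 => k _.
have [lA sA [K K0 AK]] := hA n.
have [|||b b0 bn] := approx_eigen_step hq lA K0 sA AK.
- by move=> x y; apply: eq_bigr => k _; rewrite !DA sA.
- by move=> x; rewrite /q mulr_sumr; apply: ler_sum => k _; rewrite DA.
- by [].
exists (fun k => if k == n then b else a k).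
  move=> _ x; case: eqVneq => [e0|n0]; last by apply: a0; rewrite lt0n eq_sym.
  rewrite [in A 0]e0; apply: b0; rewrite /q big1// => k _.
  by have := ltn_ord k; rewrite -[X in (_ < X)%N]e0 ltn0.
move=> e /bn[x x0' hx]; exists x => //; apply: le_trans hx.
rewrite big_ord_recr/= eqxx lerD2r le_eqVlt; apply/orP; left; apply/eqP.
by apply: eq_bigr => k _; rewrite lt_eqF//; exact: ltn_ord.
Qed.

End JointApproximateEigenvectors.

(** * Real-valued modulus of complex numbers *)

Section ComplexNumbers.
Context {R : realType}.
Local Notation C := R[i].
Implicit Types z w : C.

(** The norm on [R[i]] takes its values in [R[i]]; [cabs], and later [nm] for vectors, are the real
    values. *)
Definition cabs z : R := Re `|z|.

Lemma normE_cabs z : `|z| = (cabs z)%:C.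
Proof. by rewrite /cabs RRe_real// normr_real. Qed.

Lemma ReM z w : Re (z * w) = Re z * Re w - Im z * Im w.
Proof. by case: z; case: w. Qed.
Lemma ImM z w : Im (z * w) = Re z * Im w + Im z * Re w.
Proof. by case: z; case: w. Qed.
Lemma ReD z w : Re (z + w) = Re z + Re w.
Proof. by case: z; case: w. Qed.
Lemma ImD z w : Im (z + w) = Im z + Im w.
Proof. by case: z; case: w. Qed.
Lemma ReN z : Re (- z) = - Re z.
Proof. by case: z. Qed.
Lemma ImN z : Im (- z) = - Im z.
Proof. by case: z. Qed.
Lemma Re_conj z : Re (conjC z) = Re z.
Proof. by case: z. Qed.
Lemma Im_conj z : Im (conjC z) = - Im z.
Proof. by case: z. Qed.

Lemma Re_sum (I : Type) (r : seq I) (P : pred I) (F : I -> C) :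
  Re (\sum_(i <- r | P i) F i) = \sum_(i <- r | P i) Re (F i).
Proof. exact: (big_morph (@Re R) ReD). Qed.

Lemma complex_ext z w : Re z = Re w -> Im z = Im w -> z = w.
Proof. by case: z => a b; case: w => c d /= -> ->. Qed.

Lemma cabs_sqr z : cabs z ^+ 2 = Re z ^+ 2 + Im z ^+ 2.
Proof.
by rewrite /cabs normc_def/= sqr_sqrtr// addr_ge0// sqr_ge0.
Qed.

Lemma cabs_ge0 z : 0 <= cabs z.
Proof. by rewrite -ler0c -normE_cabs. Qed.

Lemma cabsM z w : cabs (z * w) = cabs z * cabs w.
Proof. by apply: complexI; rewrite rmorphM/= -!normE_cabs normrM. Qed.

Lemma cabsN z : cabs (- z) = cabs z.
Proof. by rewrite /cabs normrN. Qed.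

Lemma cabsX z n : cabs (z ^+ n) = cabs z ^+ n.
Proof. by apply: complexI; rewrite rmorphXn/= -!normE_cabs normrX. Qed.

Lemma cabs0 : cabs 0 = 0.
Proof. by rewrite /cabs normr0. Qed.
Lemma cabs1 : cabs 1 = 1.
Proof. by rewrite /cabs normr1. Qed.

Lemma cabs_conj z : cabs (conjC z) = cabs z.
Proof. by rewrite /cabs norm_conjC. Qed.

Lemma cabs_real (r : R) : cabs r%:C = `|r|.
Proof.
apply/eqP; rewrite -(eqrXn2 (n:=2))// ?cabs_ge0// cabs_sqr/= expr0n addr0.
by rewrite real_normK// num_real.
Qed.

Lemma cabs_eq0 z : (cabs z == 0) = (z == 0).
Proof. by rewrite -(inj_eq (@complexI R)) -normE_cabs normr_eq0. Qed.

Lemma Re_le_cabs z : `|Re z| <= cabs z.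
Proof.
rewrite -(ler_sqr (x:=`|Re z|)) ?nnegrE ?cabs_ge0// cabs_sqr real_normK ?num_real//.
by rewrite lerDl sqr_ge0.
Qed.

Lemma Im_le_cabs z : `|Im z| <= cabs z.
Proof.
rewrite -(ler_sqr (x:=`|Im z|)) ?nnegrE ?cabs_ge0// cabs_sqr real_normK ?num_real//.
by rewrite lerDr sqr_ge0.
Qed.

Lemma cabs_le_ReIm z : cabs z <= `|Re z| + `|Im z|.
Proof.
rewrite -(ler_sqr (x:=cabs z)) ?nnegrE ?cabs_ge0// ?addr_ge0//.
rewrite cabs_sqr -(real_normK (num_real (Re z))) -(real_normK (num_real (Im z))).
have := normr_ge0 (Re z); have := normr_ge0 (Im z); nra.
Qed.

Lemma mul_conj z : z * conjC z = (cabs z ^+ 2)%:C.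
Proof.
apply: complex_ext; rewrite ?ReM ?ImM Re_conj Im_conj cabs_sqr/=; ring.
Qed.

End ComplexNumbers.

(** * Geometry of the Hilbert space *)

Section HilbertSpace.
Context {R : realType} {H : hilbertType R}.
Local Notation C := R[i].
Implicit Types (x y z : H) (c : C).

Definition nm x : R := Re `|x|.
Definition rdot x y : R := Re (hdot x y).

Lemma normE x : `|x| = (nm x)%:C.
Proof. by rewrite /nm RRe_real// normr_real. Qed.

Lemma hdotC x y : hdot y x = conjC (hdot x y).
Proof. by rewrite hermC expr0 mul1r. Qed.
Lemma hdotDl x y z : hdot (x + y) z = hdot x z + hdot y z.
Proof. exact: linearDl. Qed.
Lemma hdotDr x y z : hdot x (y + z) = hdot x y + hdot x z.
Proof. exact: linearDr. Qed.
Lemma hdotZl c x y : hdot (c *: x) y = c * hdot x y.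
Proof. exact: linearZl_LR. Qed.
Lemma hdotZr c x y : hdot x (c *: y) = conjC c * hdot x y.
Proof. exact: linearZr_LR. Qed.
Lemma hdotNl x y : hdot (- x) y = - hdot x y.
Proof. exact: linearNl. Qed.
Lemma hdotNr x y : hdot x (- y) = - hdot x y.
Proof. exact: linearNr. Qed.
Lemma hdot0l y : hdot 0 y = 0.
Proof. exact: linear0l. Qed.
Lemma hdot0r y : hdot y 0 = 0.
Proof. exact: linear0r. Qed.

Lemma hdot_suml I (r : seq I) (P : pred I) (F : I -> H) y :
  hdot (\sum_(i <- r | P i) F i) y = \sum_(i <- r | P i) hdot (F i) y.
Proof. by rewrite linear_sumlz. Qed.
Lemma hdot_sumr I (r : seq I) (P : pred I) (F : I -> H) y :
  hdot y (\sum_(i <- r | P i) F i) = \sum_(i <- r | P i) hdot y (F i).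
Proof. by rewrite linear_sumr. Qed.

Lemma hdot_diag x : hdot x x = (nm x ^+ 2)%:C.
Proof. by rewrite -hdotE normE rmorphXn. Qed.

Lemma rdot_diag x : rdot x x = nm x ^+ 2.
Proof. by rewrite /rdot hdot_diag. Qed.

Lemma nm_ge0 x : 0 <= nm x.
Proof. by rewrite -ler0c -normE. Qed.

Lemma rdot_sform : sform rdot.
Proof.
split=> [x y|x y z|r x y|x]; rewrite /rdot.
- by rewrite hdotC Re_conj.
- by rewrite hdotDl ReD.
- by rewrite hdotZl ReM/= mul0r subr0.
- by rewrite -/(rdot x x) rdot_diag sqr_ge0.
Qed.

Lemma rdotC x y : rdot x y = rdot y x.
Proof. exact: sformC rdot_sform x y. Qed.

Lemma Im_hdot x y : Im (hdot x y) = - rdot ('i *: x) y.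
Proof. by rewrite /rdot hdotZl ReM/= mul0r mul1r sub0r opprK. Qed.

Lemma nmD x y : nm (x + y) <= nm x + nm y.
Proof. by rewrite -lecR rmorphD/= -!normE ler_normD. Qed.
Lemma nmN x : nm (- x) = nm x.
Proof. by rewrite /nm normrN. Qed.
Lemma nmB x y : nm (x - y) <= nm x + nm y.
Proof. by rewrite -(nmN y) nmD. Qed.
Lemma nm_distC x y : nm (x - y) = nm (y - x).
Proof. by rewrite -nmN opprB. Qed.
Lemma nmZ c x : nm (c *: x) = cabs c * nm x.
Proof. by apply: complexI; rewrite rmorphM/= -normE_cabs -!normE normrZ. Qed.
Lemma nm0 : nm 0 = 0.
Proof. by rewrite /nm normr0. Qed.
Lemma nm_eq0 x : (nm x == 0) = (x == 0).
Proof. by rewrite -(inj_eq (@complexI R)) -normE normr_eq0. Qed.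
Lemma nm_gt0 x : (0 < nm x) = (x != 0).
Proof. by rewrite lt_def nm_eq0 nm_ge0 andbT. Qed.

Lemma nm_sum I (r : seq I) (P : pred I) (F : I -> H) :
  nm (\sum_(i <- r | P i) F i) <= \sum_(i <- r | P i) nm (F i).
Proof.
elim/big_rec2: _ => [|i u v _ h]; first by rewrite nm0.
by apply: le_trans (nmD _ _) _; rewrite lerD2l.
Qed.

Lemma rdot_le x y : rdot x y <= nm x * nm y.
Proof.
have := sform_cauchy rdot_sform x y; rewrite !rdot_diag -exprMn => h.
have [/ltW r0|r0] := ltP (rdot x y) 0.
  by apply: le_trans r0 _; rewrite mulr_ge0 ?nm_ge0.
by rewrite -ler_sqr ?nnegrE// mulr_ge0 ?nm_ge0.
Qed.

(** Multiplying [x] by the conjugate of [hdot x y] makes the pairing real and nonnegative, which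
    reduces the claim to [rdot_le]. *)
Lemma hdot_le x y : cabs (hdot x y) <= nm x * nm y.
Proof.
have [->|h0] := eqVneq (hdot x y) 0; first by rewrite cabs0 mulr_ge0 ?nm_ge0.
have a0 : 0 < cabs (hdot x y) by rewrite lt_def cabs_eq0 h0 cabs_ge0.
have := rdot_le (conjC (hdot x y) *: x) y.
rewrite nmZ cabs_conj /rdot hdotZl mulrC mul_conj/= expr2 -mulrA.
by rewrite ler_pM2l.
Qed.

Lemma hdot_eq0 x : (forall y, rdot y x = 0) -> x = 0.
Proof.
move=> /(_ x) h; apply/eqP; rewrite -nm_eq0 -sqrf_eq0 -rdot_diag; exact/eqP.
Qed.

Lemma hdot_inj x y : (forall z, hdot z x = hdot z y) -> x = y.
Proof.
move=> h; apply/eqP; rewrite -subr_eq0; apply/eqP/hdot_eq0 => z.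
by rewrite /rdot hdotDr hdotNr h subrr.
Qed.

Lemma hilbert_complete (u : nat -> H) :
    (forall e : R, 0 < e ->
      exists N, forall m n, (N <= m)%N -> (N <= n)%N -> nm (u m - u n) <= e) ->
  exists l, forall e : R, 0 < e ->
    exists N, forall n, (N <= n)%N -> nm (u n - l) <= e.
Proof.
move=> hu.
have posR (e : C) : 0 < e -> 0 < Re e /\ e = (Re e)%:C.
  by case: e => a b; rewrite ltcE/= => /andP[/eqP-> ->].
have : cvg (u @ \oo).
  apply: cauchy_cvg; apply: cauchy_exP => e /posR[e0 ->].
  have [|N hN] := hu (Re e / 2); first by rewrite divr_gt0.
  exists (u N); exists N => // n /= Nn.
  rewrite -ball_normE/= normE ltcR.
  by apply: le_lt_trans (hN _ _ (leqnn N) Nn) _; lra.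
move=> /cvg_ex[l /cvgrPdist_le ul]; exists l => e e0.
have [|N _ hN] := ul e%:C; first by rewrite ltcR.
by exists N => n Nn; have := hN n Nn; rewrite normE lecR nm_distC.
Qed.

End HilbertSpace.

Lemma ler_of_sqr (R : realType) (x y : R) : 0 <= y -> x ^+ 2 <= y ^+ 2 -> x <= y.
Proof. move=> y0; move=> h; rewrite leNgt; apply/negP => xy; nra. Qed.

(** * Lax-Milgram, adjoints and inverses of bounded operators *)

Section BoundedOperators.
Context {R : realType} {H : hilbertType R}.
Local Notation C := R[i].
Implicit Types (x y z : H) (c : C) (A B T : H -> H).

Lemma opD_E A B x : (A + B) x = A x + B x.
Proof. by []. Qed.
Lemma opZ_E c A x : (c *: A) x = c *: A x.
Proof. by []. Qed.
Lemma op0_E x : (0 : H -> H) x = 0.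
Proof. by []. Qed.
Definition op_E := (opD_E, opZ_E, op0_E).

Lemma linear_opD A x y : linear A -> A (x + y) = A x + A y.
Proof. by move=> /(_ 1 x y); rewrite !scale1r. Qed.
Lemma linear_op0 A : linear A -> A 0 = 0.
Proof.
move=> /(linear_opD 0 0); rewrite addr0 => h.
by apply: (addrI (A 0)); rewrite -h addr0.
Qed.
Lemma linear_opZ A c x : linear A -> A (c *: x) = c *: A x.
Proof. by move=> hA; have := hA c x 0; rewrite !addr0 (linear_op0 hA) addr0. Qed.
Lemma linear_opN A x : linear A -> A (- x) = - A x.
Proof. by move=> hA; rewrite -scaleN1r linear_opZ// scaleN1r. Qed.
Lemma linear_opB A x y : linear A -> A (x - y) = A x - A y.
Proof. by move=> hA; rewrite linear_opD// linear_opN. Qed.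
Lemma linear_op_sum A I (r : seq I) (P : pred I) (F : I -> H) : linear A ->
  A (\sum_(i <- r | P i) F i) = \sum_(i <- r | P i) A (F i).
Proof.
by move=> hA; apply: (big_morph A (fun x y => linear_opD x y hA) (linear_op0 hA)).
Qed.

Lemma bounded_opP A : bounded_op A ->
  exists2 M : R, 0 <= M & forall x, nm (A x) <= M * nm x.
Proof.
move=> [_ [M hM]]; exists `|M| => // x.
have := hM x; rewrite !normE -rmorphM/= lecR => h; apply: le_trans h _.
by rewrite ler_wpM2r ?nm_ge0// ler_norm.
Qed.

Lemma bounded_op_intro A (M : R) :
  linear A -> (forall x, nm (A x) <= M * nm x) -> bounded_op A.
Proof.
by move=> hA hM; split=> //; exists M => x; rewrite !normE -rmorphM/= lecR.
Qed.

Lemma bounded_op_id : bounded_op (idfun : H -> H).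
Proof. by apply: (@bounded_op_intro _ 1) => // x; rewrite mul1r. Qed.

Lemma bounded_op_comb c A B :
  bounded_op A -> bounded_op B -> bounded_op (c *: A + B).
Proof.
move=> hA hB; have [M M0 AM] := bounded_opP hA; have [K K0 BK] := bounded_opP hB.
apply: (@bounded_op_intro _ (cabs c * M + K)) => [a x y|x].
  rewrite !op_E (proj1 hA) (proj1 hB) !scalerDr !scalerA mulrC.
  by rewrite -!addrA; congr (_ + _); rewrite addrCA.
rewrite !op_E; apply: le_trans (nmD _ _) _; rewrite mulrDl nmZ lerD//.
by rewrite -mulrA ler_wpM2l ?cabs_ge0.
Qed.

Lemma bounded_op_comp A B : bounded_op A -> bounded_op B -> bounded_op (A \o B).
Proof.
move=> hA hB; have [M M0 AM] := bounded_opP hA; have [K K0 BK] := bounded_opP hB.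
apply: (@bounded_op_intro _ (M * K)) => [a x y|x] /=.
  by rewrite (proj1 hB) (proj1 hA).
by apply: le_trans (AM _) _; rewrite -mulrA ler_wpM2l.
Qed.

Lemma bounded_op0 : bounded_op (0 : H -> H).
Proof.
apply: (@bounded_op_intro _ 0) => [a x y|x]; rewrite !op_E ?scaler0 ?addr0//.
by rewrite nm0 mul0r.
Qed.

Lemma bounded_opZ c A : bounded_op A -> bounded_op (c *: A).
Proof.
by move=> hA; rewrite -[_ *: _]addr0; exact: bounded_op_comb bounded_op0.
Qed.

Lemma bounded_opD A B : bounded_op A -> bounded_op B -> bounded_op (A + B).
Proof. by move=> hA hB; rewrite -[A]scale1r; exact: bounded_op_comb. Qed.

Lemma bounded_op_sum I (r : seq I) (P : pred I) (F : I -> H -> H) :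
  (forall i, bounded_op (F i)) -> bounded_op (\sum_(i <- r | P i) F i).
Proof.
move=> hF; elim/big_rec: _ => [|i A _ hA]; first exact: bounded_op0.
exact: bounded_opD.
Qed.

(* The minimum of [b x x - 2 f x]; the parallelogram identity makes a
   minimizing sequence Cauchy. *)
Lemma symmetric_lax_milgram (b : H -> H -> R) (f : H -> R) (d K M : R) :
    sform b -> 0 < d -> (forall x, d * nm x ^+ 2 <= b x x) ->
    (forall x, b x x <= K * nm x ^+ 2) ->
    (forall x y, f (x + y) = f x + f y) -> (forall r x, f (r%:C *: x) = r * f x) ->
    (forall x, f x <= M * nm x) ->
  exists z, forall x, b z x = f x.
Proof.
move=> hb d0 bd bK fD fZ fM.
have fN x : f (- x) = - f x by rewrite -scaleN1C fZ mulN1r.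
pose J x := b x x - 2 * f x.
have Jlow x : - (M ^+ 2 / d) <= J x.
  have := bd x; have := fM x; rewrite /J => h1 h2.
  have : 0 <= d^-1 * (d * nm x - M) ^+ 2 by rewrite mulr_ge0 ?sqr_ge0// invr_ge0 ltW.
  have -> : d^-1 * (d * nm x - M) ^+ 2 = d * nm x ^+ 2 - 2 * (M * nm x) + M ^+ 2 / d.
    by field; rewrite gt_eqF.
  lra.
pose S := [set J x | x in [set: H]].
have hS : has_inf S.
  split; first by exists (J 0); exists 0.
  by exists (- (M ^+ 2 / d)) => _ [x _ <-].
pose m := inf S.
have mJ x : m <= J x by apply: ge_inf; [exact: (proj2 hS) | exists x].
have approx (n : nat) : exists x, J x < m + n.+1%:R^-1.
  have [|_ [x _ <-] hx] := @inf_adherent _ S n.+1%:R^-1 _ hS; last by exists x.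
  by rewrite invr_gt0 ltr0Sn.
have [u hu] := choice approx.
have close x y (e : R) : J x < m + e -> J y < m + e -> d * nm (x - y) ^+ 2 <= 4 * e.
  move=> hx hy; apply: le_trans (bd _) _.
  have := mJ ((1/2)%:C *: (x + y)); move: hx hy; rewrite /J fZ fD.
  rewrite !(sformE hb) (sformC hb y x); lra.
have inv_small (e : R) : 0 < e -> exists N : nat, forall n, (N <= n)%N -> n.+1%:R^-1 < e.
  move=> e0; have ie : 0 < e^-1 by rewrite invr_gt0.
  exists (Num.bound e^-1) => n Nn.
  rewrite -[e]invrK ltf_pV2 ?posrE// ?ltr0Sn//.
  apply: lt_le_trans (archi_boundP (ltW ie)) _; rewrite ler_nat.
  exact: leqW.
have [|z hz] := @hilbert_complete _ _ u.
  move=> e e0; have [|N hN] := inv_small (d * e ^+ 2 / 4).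
    by rewrite divr_gt0// mulr_gt0// exprn_gt0.
  exists N => i j Ni Nj.
  have h : d * nm (u i - u j) ^+ 2 <= 4 * (d * e ^+ 2 / 4).
    apply: close; [apply: lt_trans (hu i) _|apply: lt_trans (hu j) _];
      by rewrite ltrD2l hN.
  apply: ler_of_sqr (ltW e0) _; rewrite -(ler_pM2l d0); lra.
exists z => x; apply/eqP; rewrite -subr_eq0 -normr_le0.
apply/ler_addgt0Pl => e e0; rewrite addr0.
have Bx := sform_ge0 hb x; set B := b x x in Bx.
(* [t] is tuned to [var] below: at [s = t] and [s = - t] it bounds the absolute value of
   [b (u n) x - f x] by [t * (B + 1) / 2 = e / 2]. *)
pose t := e / (B + 1).
have t0 : 0 < t by rewrite divr_gt0//; lra.
have tB : t * (B + 1) = e by rewrite /t; field; rewrite gt_eqF//; lra.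
have [|N1 hN1] := inv_small (t ^+ 2); first by rewrite exprn_gt0.
(* [g] is tuned to Cauchy-Schwarz: (|K| + 1) g (B + 1) = (e / 2)^2. The cap at 1 below turns a bound
   of a norm by [minr 1 g] into a bound of its square by [g]. *)
pose g := e ^+ 2 / 4 / ((`|K| + 1) * (B + 1)).
have K1 : 0 < (`|K| + 1) * (B + 1).
  by rewrite mulr_gt0//; have := normr_ge0 K; lra.
have g0 : 0 < g by rewrite !divr_gt0// exprn_gt0.
have [|N2 hN2] := hz (minr 1 g); first by rewrite lt_min ltr01 g0.
pose n := maxn N1 N2.
have /ltW en := hN1 n (leq_maxl _ _); have zn := hN2 n (leq_maxr _ _).
have var s : 2 * s * (b (u n) x - f x) + s ^+ 2 * B >= - t ^+ 2.
  have := mJ (u n + s%:C *: x); have := hu n; rewrite /J fD fZ.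
  rewrite !(sformE hb) (sformC hb x (u n)) -/B => h1 h2.
  have -> : 2 * s * (b (u n) x - f x) + s ^+ 2 * B =
    (b (u n) (u n) + s * b (u n) x + s * (b (u n) x + s * B)
       - 2 * (f (u n) + s * f x)) - (b (u n) (u n) - 2 * f (u n)) by ring.
  move: h1 en; move: (n.+1%:R^-1) (t ^+ 2) => v w; lra.
have D1 : `|b (u n) x - f x| <= e / 2.
  have v1 := var t; have v2 := var (- t).
  rewrite ler_norml; apply/andP; split; rewrite -(ler_pM2l t0); nra.
have D2 : `|b (u n) x - b z x| <= e / 2.
  apply: ler_of_sqr; first by rewrite divr_ge0// ltW.
  rewrite real_normK ?num_real//.
  rewrite -(sformNl hb) -(sformDl hb).
  apply: le_trans (sform_cauchy hb _ _) _; rewrite -/B.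
  have nn : nm (u n - z) ^+ 2 <= g.
    have : minr 1 g <= 1 by rewrite ge_min lexx.
    have : minr 1 g <= g by rewrite ge_min lexx orbT.
    have := nm_ge0 (u n - z); nra.
  have b1 : b (u n - z) (u n - z) <= (`|K| + 1) * g.
    apply: le_trans (bK _) _; have := ler_norm K; have := normr_ge0 K.
    have := sqr_ge0 (nm (u n - z)); nra.
  have : b (u n - z) (u n - z) * B <= (`|K| + 1) * g * (B + 1).
    by have := sform_ge0 hb (u n - z); nra.
  suff -> : (`|K| + 1) * g * (B + 1) = (e / 2) ^+ 2 by [].
  rewrite /g; field; have := normr_ge0 K => K0.
  by rewrite !gt_eqF//; lra.
have -> : b z x - f x = (b (u n) x - f x) - (b (u n) x - b z x) by ring.
apply: le_trans (ler_normB _ _) _; lra.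
Qed.

Lemma riesz_adj A y : bounded_op A ->
  exists z, forall x, hdot (A x) y = hdot x z.
Proof.
move=> hA; have [M M0 AM] := bounded_opP hA; have [lA _] := hA.
have [| | | | |z hz] := @symmetric_lax_milgram rdot (fun x => rdot (A x) y)
    1 1 (M * nm y) rdot_sform ltr01.
- by move=> x; rewrite mul1r rdot_diag.
- by move=> x; rewrite mul1r rdot_diag.
- by move=> x x'; rewrite linear_opD// (sformDl rdot_sform).
- by move=> r x; rewrite linear_opZ// (sformZl rdot_sform).
- move=> x; apply: le_trans (rdot_le _ _) _.
  by rewrite mulrAC ler_wpM2r ?nm_ge0.
have hz' x : rdot (A x) y = rdot x z by rewrite -hz rdotC.
exists z => x; apply: complex_ext; first exact: hz'.
by rewrite !Im_hdot -linear_opZ// hz'.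
Qed.

Lemma adjP A : bounded_op A -> forall x y, hdot (A x) y = hdot x (adj A y).
Proof. by move=> hA x y; have := @xgetPex _ 0 _ (riesz_adj y hA); apply. Qed.

Lemma rdot_adj A : bounded_op A -> forall x y, rdot (A x) y = rdot x (adj A y).
Proof. by move=> hA x y; rewrite /rdot adjP. Qed.

Lemma adj_unique A B : (forall x y, hdot (A x) y = hdot x (B y)) -> adj A = B.
Proof.
move=> h; apply/funext => y; apply: hdot_inj => x; rewrite -h.
have ex : exists z, forall x, hdot (A x) y = hdot x z by exists (B y) => x'.
by rewrite (@xgetPex _ 0 _ ex).
Qed.

Lemma nm_adj_le A (M : R) : bounded_op A -> 0 <= M ->
  (forall x, nm (A x) <= M * nm x) -> forall y, nm (adj A y) <= M * nm y.
Proof.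
move=> hA M0 AM y.
have [->|a0] := eqVneq (nm (adj A y)) 0; first by rewrite mulr_ge0 ?nm_ge0.
have a1 : 0 < nm (adj A y) by rewrite lt_def a0 nm_ge0.
rewrite -(ler_pM2l a1) -expr2 -rdot_diag -rdot_adj//.
apply: le_trans (rdot_le _ _) _; rewrite mulrCA mulrA.
by rewrite ler_wpM2r ?nm_ge0.
Qed.

Lemma adj_bounded A : bounded_op A -> bounded_op (adj A).
Proof.
move=> hA; have [M M0 AM] := bounded_opP hA.
apply: (@bounded_op_intro _ M) => [c x y|y]; last exact: nm_adj_le.
by apply: hdot_inj => z; rewrite -adjP// !hdotDr !hdotZr !adjP.
Qed.

Lemma adjK A : bounded_op A -> adj (adj A) = A.
Proof.
by move=> hA; apply: adj_unique => x y; rewrite hdotC -adjP// -hdotC.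
Qed.

Lemma adj_id : adj (idfun : H -> H) = idfun.
Proof. exact: adj_unique. Qed.

Lemma adj_comb c A B : bounded_op A -> bounded_op B ->
  adj (c *: A + B) = conjC c *: adj A + adj B.
Proof.
move=> hA hB; apply: adj_unique => x y.
by rewrite !op_E hdotDl hdotZl hdotDr hdotZr conjCK !adjP.
Qed.

Lemma adj_comp A B : bounded_op A -> bounded_op B ->
  adj (A \o B) = adj B \o adj A.
Proof. by move=> hA hB; apply: adj_unique => x y /=; rewrite !adjP. Qed.

Lemma adj0 : adj (0 : H -> H) = 0.
Proof. by apply: adj_unique => x y; rewrite !op_E hdot0l hdot0r. Qed.

(** The symmetric Lax-Milgram lemma is applied to [A \o adj A]: the adjoint has the same real
    quadratic form as [A], hence the same lower bound [d], and solving [A (adj A z) = y] gives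
    surjectivity. The lower bound on [A] gives injectivity and bounds the inverse by [d^-1]. *)
Lemma coercive_inverse A (d : R) : bounded_op A -> 0 < d ->
    (forall x, d * nm x ^+ 2 <= rdot (A x) x) ->
  exists2 B, bounded_op B & cancel B A /\ cancel A B.
Proof.
move=> hA d0 Ad; have hA' := adj_bounded hA; have [lA _] := hA.
have [M M0 AM] := bounded_opP hA'; have [lA' _] := hA'.
have low x : d * nm x <= nm (A x).
  have [->|x0] := eqVneq (nm x) 0; first by rewrite mulr0 nm_ge0.
  have x1 : 0 < nm x by rewrite lt_def x0 nm_ge0.
  rewrite -(ler_pM2r x1) -mulrA -expr2.
  exact: le_trans (Ad x) (rdot_le _ _).
have low' x : d * nm x <= nm (adj A x).
  have [->|x0] := eqVneq (nm x) 0; first by rewrite mulr0 nm_ge0.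
  have x1 : 0 < nm x by rewrite lt_def x0 nm_ge0.
  rewrite -(ler_pM2r x1) -mulrA -expr2 [leRHS]mulrC.
  by apply: le_trans (Ad x) _; rewrite rdot_adj// rdot_le.
have inj x y : A x = A y -> x = y.
  move=> h; apply/eqP; rewrite -subr_eq0 -nm_eq0 eq_le nm_ge0 andbT.
  by have := low (x - y); rewrite linear_opB// h subrr nm0 pmulr_rle0.
have surj y : exists x, A x = y.
  have [| | | | | | |z hz] := @symmetric_lax_milgram
      (fun x x' => rdot (adj A x) (adj A x')) (fun x => rdot y x)
      (d ^+ 2) (M ^+ 2) (nm y).
  - split=> [x x'|x x' x''|r x x'|x].
    + exact: rdotC.
    + by rewrite linear_opD// (sformDl rdot_sform).
    + by rewrite linear_opZ// (sformZl rdot_sform).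
    + exact: sform_ge0 rdot_sform _.
  - by rewrite exprn_gt0.
  - move=> x; rewrite rdot_diag -exprMn ler_sqr ?nnegrE ?nm_ge0//.
    by rewrite mulr_ge0 ?nm_ge0// ltW.
  - move=> x; rewrite rdot_diag -exprMn ler_sqr ?nnegrE ?nm_ge0//.
    by rewrite mulr_ge0 ?nm_ge0.
  - by move=> x x'; rewrite (sformDr rdot_sform).
  - by move=> r x; rewrite (sformZr rdot_sform).
  - by move=> x; exact: rdot_le.
  exists (adj A z); apply/eqP; rewrite -subr_eq0; apply/eqP/hdot_eq0 => x.
  rewrite (sformDr rdot_sform) (sformNr rdot_sform).
  by rewrite (rdotC x (A _)) rdot_adj// hz (rdotC y) subrr.
have [B hB] := choice surj.
exists B => //; last by split=> // x; apply: inj.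
apply: (@bounded_op_intro _ d^-1) => [c x y|x].
  by apply: inj; rewrite lA !hB.
by rewrite ler_pdivlMl// -[in leRHS](hB x).
Qed.

End BoundedOperators.

(** * The Koszul complex and its contraction *)

Section Koszul.
Context {R : realType} {H : hilbertType R} {d : nat}.
Local Notation C := R[i].
Variable T : d.-tuple (H -> H).
Hypothesis T_linear : forall j, linear (tnth T j).
Hypothesis T_commuting : commuting T.
Implicit Types (S : {set 'I_d}) (xi : {ffun {set 'I_d} -> H}).

Definition koszul_sign (j : 'I_d) S : C := (-1) ^+ #|[set i in S | (i < j)%N]|.

Lemma koszul_signU1 j k S : j \notin S ->
  koszul_sign k (j |: S)%SET = (-1) ^+ (j < k)%N * koszul_sign k S.
Proof.
move=> jS; rewrite /koszul_sign -exprD; congr (_ ^+ _).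
case: (ltnP j k) => jk.
  have -> : ([set i in j |: S | (i < k)%N] = j |: [set i in S | (i < k)%N])%SET.
    by apply/setP => i; rewrite !inE; case: eqP => [->|_] //=.
  by rewrite cardsU1 !inE (negPf jS).
congr #|pred_of_set _|; apply/setP => i; rewrite !inE.
by case: eqP => [->|_] //=; rewrite ltnNge jk (negPf jS).
Qed.

Lemma koszul_sign0 j : koszul_sign j finset.set0 = 1.
Proof. by rewrite /koszul_sign eq_card0// => i; rewrite !inE. Qed.

Lemma koszul_signK j S x : koszul_sign j S *: (koszul_sign j S *: x) = x :> H.
Proof. by rewrite scalerA -expr2 -exprM mulnC exprM sqrrN !expr1n scale1r. Qed.

Lemma sign_lt_swap (j k : 'I_d) : j != k ->
  (-1) ^+ (j < k)%N = - (-1) ^+ (k < j)%N :> C.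
Proof.
move=> jk; case: ltngtP => //= [_|/val_inj jk']; first by rewrite opprK.
by rewrite jk' eqxx in jk.
Qed.

Lemma koszul_bdE xi S : koszul_bd T xi S =
  \sum_(j | j \notin S) koszul_sign j S *: tnth T j (xi (j |: S)%SET).
Proof. by rewrite ffunE. Qed.

(** The double sum runs over ordered pairs of distinct indices outside [S]. Exchanging the two flips
    the sign [(-1) ^+ (j < k)] and, by commutation, nothing else, so the sum equals its own
    negative. *)
Lemma koszul_bd_bd xi : koszul_bd T (koszul_bd T xi) = 0.
Proof.
apply/ffunP => S; rewrite koszul_bdE ffunE.
pose G j k : H := if [&& j \notin S, k \notin S & j != k] then
  ((-1) ^+ (j < k)%N * (koszul_sign j S * koszul_sign k S)) *:
    tnth T j (tnth T k (xi (j |: (k |: S))%SET)) else 0.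
have -> : \sum_(j | j \notin S)
    koszul_sign j S *: tnth T j (koszul_bd T xi (j |: S)%SET) =
    \sum_j \sum_k G j k.
  rewrite big_mkcond/=; apply: eq_bigr => j _; rewrite /G.
  case: ifPn => jS; last by rewrite big1.
  rewrite koszul_bdE linear_op_sum// scaler_sumr big_mkcond/=.
  apply: eq_bigr => k _; rewrite in_setU1 negb_or eq_sym andbC.
  case: ifPn => // /andP[kS jk].
  rewrite koszul_signU1// !(linear_opZ _ _ (T_linear _)) scalerA mulrCA.
  by rewrite finset.setUCA.
have GN j k : G j k = - G k j.
  rewrite /G eq_sym andbCA; case: ifPn => [/and3P[jS kS jk]|]; last by rewrite oppr0.
  rewrite sign_lt_swap 1?eq_sym// mulNr scaleNr (mulrC (koszul_sign j S)) finset.setUCA.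
  by congr (- (_ *: _)); rewrite -[LHS]/((tnth T j \o tnth T k) _) T_commuting.
set X := \sum_j _; have XN : X = - X.
  rewrite {1}/X exchange_big/= -sumrN; apply: eq_bigr => j _.
  by rewrite -sumrN; apply: eq_bigr => k _.
have : (2%:R : C) *: X = 0 by rewrite scaler_nat mulr2n {1}XN addNr.
by move/eqP; rewrite scaler_eq0 pnatr_eq0 => /eqP.
Qed.

(* [xi] is contracted by the homotopy given by the exterior product with
   [sum_j c_j e_j], composed with the inverse [B] of [sum_j c_j T_j]. *)
Lemma koszul_exact_of_inverse (c : 'I_d -> C) (B : H -> H) :
    linear B -> (forall j x, B (tnth T j x) = tnth T j (B x)) ->
    (forall x, \sum_j c j *: tnth T j (B x) = x) -> koszul_exact T.
Proof.
move=> lB BT BK p.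
pose h xi : {ffun {set 'I_d} -> H} := [ffun S : {set 'I_d} =>
  \sum_(k in S) (koszul_sign k S * c k) *: B (xi (S :\ k)%SET)].
(* At [S], adding and removing the same index [j] contributes [c j *: T_j B (xi S)], from one
   composite if [j] is in [S] and from the other if not; these add up to [xi S]. Adding [j] and
   removing another index [k] gives [F k j], which occurs in both composites with opposite signs. *)
have homotopy xi : koszul_bd T (h xi) + h (koszul_bd T xi) = xi.
  apply/ffunP => S; rewrite !ffunE -[RHS]BK [RHS](bigID (mem S))/= addrC.
  pose F k j : H := (koszul_sign k S * c k * koszul_sign j (S :\ k)%SET) *:
    tnth T j (B (xi (j |: (S :\ k))%SET)).
  have -> : \sum_(k in S) (koszul_sign k S * c k) *: B (koszul_bd T xi (S :\ k)%SET) =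
    \sum_(k in S) c k *: tnth T k (B (xi S)) +
    \sum_(k in S) \sum_(j | j \notin S) F k j.
    rewrite -big_split/=; apply: eq_bigr => k kS.
    rewrite koszul_bdE linear_op_sum// scaler_sumr.
    rewrite (bigD1 k)/= ?in_setD1 ?eqxx//; congr (_ + _).
      rewrite linear_opZ// BT finset.setD1K// scalerA mulrAC.
      rewrite -{1}(finset.setD1K kS) koszul_signU1 ?in_setD1 ?eqxx// ltnn mul1r.
      by rewrite -!scalerA koszul_signK.
    apply: eq_big => [j|j /andP[_ _]].
      rewrite in_setD1 negb_and negbK; case: eqVneq => [->|_] /=; last by rewrite andbT.
      by rewrite kS.
    by rewrite linear_opZ// BT scalerA.
  have -> : \sum_(j | j \notin S)
      koszul_sign j S *: tnth T j (h xi (j |: S)%SET) =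
    \sum_(j | j \notin S) c j *: tnth T j (B (xi S)) -
    \sum_(k in S) \sum_(j | j \notin S) F k j.
    rewrite [X in _ - X]exchange_big/= -sumrB; apply: eq_bigr => j jS.
    rewrite ffunE linear_op_sum// scaler_sumr.
    rewrite (bigD1 j)/= ?in_setU1 ?eqxx//; congr (_ + _).
      rewrite linear_opZ// finset.setU1K// scalerA mulrA.
      by rewrite koszul_signU1// ltnn mul1r -!scalerA koszul_signK.
    rewrite -sumrN; apply: eq_big => [k|k].
      rewrite in_setU1; case: eqVneq => [->|_] /=; last by rewrite andbT.
      by rewrite (negPf jS).
    rewrite in_setU1 => /andP[/orP[/eqP->|kS]]; first by rewrite eqxx.
    move=> kj; rewrite linear_opZ// scalerA /F -scaleNr.
    have -> : ((j |: S) :\ k = j |: (S :\ k))%SET.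
      apply/setP => i; rewrite !inE; case: (eqVneq i j) => [->|_] //=.
      by rewrite eq_sym kj.
    congr (_ *: _); rewrite koszul_signU1//.
    rewrite -{1}(finset.setD1K kS) (koszul_signU1 j) ?in_setD1 ?eqxx//.
    rewrite (sign_lt_swap (j:=k))//; case: (j < k)%N; rewrite ?expr0 ?expr1; ring.
  by rewrite [X in _ + X]addrC addrA subrK.
apply/seteqP; split=> [xi [xip bd0]|_ [xi xip <-]] /=.
  exists (h xi); last first.
    rewrite -[RHS]homotopy bd0; set h0 := h 0.
    suff -> : h0 = 0 by rewrite addr0.
    apply/ffunP => S; rewrite !ffunE big1// => k _.
    by rewrite ffunE linear_op0// scaler0.
  move=> S Sp; rewrite ffunE big1// => k kS.
  rewrite xip ?(linear_op0 lB) ?scaler0//; apply: contra_neq Sp => <-.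
  by rewrite (cardsD1 k S) kS.
split; last exact: koszul_bd_bd.
move=> S Sp; rewrite koszul_bdE big1// => j jS.
rewrite xip ?(linear_op0 (T_linear j)) ?scaler0//; apply: contra_neq Sp.
by rewrite cardsU1 jS => -[].
Qed.

End Koszul.

Lemma cabs_nat (R : realType) n : cabs (n%:R : R[i]) = n%:R.
Proof. by apply: complexI; rewrite -normE_cabs normr_nat rmorph_nat. Qed.

(** * Cauchy estimates for vector-valued polynomials *)

Section VectorPolynomials.
Context {R : realType} {H : hilbertType R}.
Local Notation C := R[i].
Implicit Types (f : C -> H) (c : nat -> H).

Definition vpoly n c (z : C) : H := \sum_(k < n) z ^+ k *: c k.

Lemma big_ord_double (F : nat -> H) n :
  \sum_(k < n.*2) F k = \sum_(k < n) (F k.*2 + F k.*2.+1).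
Proof.
elim: n => [|n IH]; first by rewrite !big_ord0.
by rewrite doubleS !big_ord_recr/= IH addrA.
Qed.

(* The even part of the polynomial is a polynomial of half the degree in
   [z ^+ 2]. *)
Lemma vpoly_cauchy0 m c (r B : R) : 0 <= r ->
  (forall z, cabs z = r -> nm (vpoly (2 ^ m) c z) <= B) -> nm (c 0) <= B.
Proof.
elim: m c r => [|m IH] c r r0 hB.
  have := hB r%:C; rewrite cabs_real ger0_norm// => /(_ erefl).
  by rewrite /vpoly expn0 big_ord1 expr0 scale1r.
apply: (IH (fun k => c k.*2) (r ^+ 2)) => [|w wr]; first exact: sqr_ge0.
pose z := sqrtc w; have zz : z ^+ 2 = w by exact: sqr_sqrtc.
have zr : cabs z = r.
  by apply/eqP; rewrite -(eqrXn2 (n:=2))// ?cabs_ge0// -cabsX zz wr.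
have := hB z zr; have := hB (- z); rewrite cabsN => /(_ zr).
rewrite expnS mul2n; set L := (2 ^ m)%N => h1 h2.
have E : (2%:R : C) *: vpoly L (fun k => c k.*2) w =
    vpoly L.*2 c z + vpoly L.*2 c (- z).
  rewrite /vpoly !(big_ord_double (fun k => _ ^+ k *: c k)) scaler_sumr.
  rewrite -big_split/=; apply: eq_bigr => k _.
  rewrite -zz -exprM mul2n (exprNn z k.*2) (exprNn z k.*2.+1) (exprS (-1)).
  have -> : (-1) ^+ k.*2 = 1 :> C by rewrite -signr_odd odd_double.
  rewrite mulr1 mul1r mulN1r scaleNr addrACA addrN addr0.
  by rewrite scaler_nat mulr2n.
have := nmD (vpoly L.*2 c z) (vpoly L.*2 c (- z)); rewrite -E nmZ.
rewrite cabs_nat; lra.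
Qed.

(** [x] is the derivative at 0 of the polynomial map [f]. With [n.+2] coefficients the index 1 is in
    range. *)
Definition vpoly_coef1 f x := exists n c, f =1 vpoly n.+2 c /\ c 1 = x.

Lemma vpoly_at0 n c : vpoly n.+1 c 0 = c 0.
Proof.
rewrite /vpoly big_ord_recl expr0 scale1r big1 ?addr0// => i _.
by rewrite exprS mul0r scale0r.
Qed.

Lemma vpoly_widen m n c z : (n <= m)%N ->
  vpoly n c z = vpoly m (fun k => if (k < n)%N then c k else 0) z.
Proof.
move=> nm; rewrite /vpoly (big_ord_widen m (fun k => z ^+ k *: c k))// big_mkcond.
by apply: eq_bigr => k _; case: ifP => // _; rewrite scaler0.
Qed.

(** Cauchy's estimate for the derivative at 0: [vpoly_cauchy0] is applied to the difference quotient
    [(f z - f 0) / z], whose shifted coefficients are padded with zeros up to a power of two. The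
    quotient is the source of the term [nm (f 0)]. *)
Lemma vpoly_cauchy1 f x (r B : R) : vpoly_coef1 f x -> 0 < r ->
  (forall z, cabs z = r -> nm (f z) <= B) -> r * nm x <= B + nm (f 0).
Proof.
move=> [n [c [fE <-]]] r0 hB.
rewrite mulrC -ler_pdivlMr//.
pose c' k := if (k < n.+1)%N then c k.+1 else 0.
apply: (@vpoly_cauchy0 n.+1 c' r) => [|z zr]; first exact: ltW.
have lt2 : (n.+1 <= 2 ^ n.+1)%N by exact/ltnW/ltn_expl.
rewrite -(vpoly_widen (fun k => c k.+1) z lt2) ler_pdivlMr// mulrC -{1}zr -nmZ.
have -> : z *: vpoly n.+1 (fun k => c k.+1) z = f z - f 0.
  rewrite !fE vpoly_at0 /vpoly [in RHS]big_ord_recl expr0 scale1r addrC addrA addNr add0r.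
  by rewrite scaler_sumr; apply: eq_bigr => k _; rewrite scalerA -exprS.
by apply: le_trans (nmB _ _) _; rewrite lerD2r hB.
Qed.

Lemma vpoly_coef1_cst x : vpoly_coef1 (fun=> x) 0.
Proof.
exists 0, (fun k => if k == 0 then x else 0); split=> // z.
by rewrite /vpoly !big_ord_recl big_ord0/= expr0 scale1r scaler0 !addr0.
Qed.

Lemma vpoly_coef1_linear f x (A : H -> H) : linear A ->
  vpoly_coef1 f x -> vpoly_coef1 (A \o f) (A x).
Proof.
move=> lA [n [c [fE <-]]]; exists n, (A \o c); split=> // z /=.
rewrite fE (linear_op_sum _ _ _ lA); apply: eq_bigr => k _.
by rewrite linear_opZ.
Qed.

(** The product rule at 0 for the factor 1 + z s A. *)
Lemma vpoly_coef1_factor f x (A : H -> H) (s : C) : linear A ->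
  vpoly_coef1 f x ->
  vpoly_coef1 (fun z => f z + (z * s) *: A (f z)) (x + s *: A (f 0)).
Proof.
move=> lA [n [c [fE <-]]].
exists n.+1, (fun k => (if (k < n.+2)%N then c k else 0) +
                       if k is j.+1 then s *: A (c j) else 0).
split=> [z|]; last by rewrite /= fE vpoly_at0.
rewrite !fE {1}(vpoly_widen c z (leqnSn _)) /vpoly.
rewrite (eq_bigr _ (fun i _ => scalerDr _ _ _)) big_split/=; congr (_ + _).
rewrite [in RHS]big_ord_recl scaler0 add0r.
rewrite (linear_op_sum _ _ _ lA) scaler_sumr; apply: eq_bigr => k _.
by rewrite linear_opZ// !scalerA exprS; congr (_ *: _); ring.
Qed.

Lemma vpoly_coef1_iter f x (A : H -> H) (s : C) n : linear A ->
  vpoly_coef1 f x ->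
  vpoly_coef1 (fun z => iter n (fun y => y + (z * s) *: A y) (f z))
    (x + (n%:R * s) *: A (f 0)).
Proof.
move=> lA hf; elim: n => [|n IH] /=; first by rewrite mul0r scale0r addr0.
have := vpoly_coef1_factor s lA IH.
have -> : iter n (fun y => y + (0 * s) *: A y) (f 0) = f 0.
  by elim: n {IH} => //= n ->; rewrite mul0r scale0r addr0.
by rewrite -addrA -scalerDl -natr1 mulrDl mul1r.
Qed.

End VectorPolynomials.

(** * Fuglede's theorem *)

Section Fuglede.
Context {R : realType} {H : hilbertType R}.
Local Notation C := R[i].
Implicit Types (f g : H -> H) (x y : H).

Lemma iter_commute (X : Type) (f g : X -> X) n (x : X) :
  (forall u : X, f (g u) = g (f u)) -> iter n f (g x) = g (iter n f x).
Proof. by move=> fg; elim: n => //= n ->. Qed.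

Lemma iter_comp (X : Type) (f g : X -> X) n (x : X) : (forall u : X, f (g u) = g (f u)) ->
  iter n f (iter n g x) = iter n (f \o g) x.
Proof.
move=> fg; elim: n => //= n <-; congr f.
by rewrite iter_commute// => y.
Qed.

Lemma nm_iter f n (t : R) x : 0 <= t -> (forall x, nm (f x) <= t * nm x) ->
  nm (iter n f x) <= t ^+ n * nm x.
Proof.
move=> t0 ft; elim: n => [|n IH] /=; first by rewrite mul1r.
by apply: le_trans (ft _) _; rewrite exprS -mulrA ler_wpM2l.
Qed.

Lemma nm_iter_sub f n (q : R) x : 0 <= q -> (forall x, nm (x - f x) <= q * nm x) ->
  nm (x - iter n f x) <= ((1 + q) ^+ n - 1) * nm x.
Proof.
move=> q0 fq; elim: n => [|n IH] /=; first by rewrite subrr nm0 expr0 subrr mul0r.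
have ft y : nm (f y) <= (1 + q) * nm y.
  rewrite -(subKr y (f y)) mulrDl mul1r.
  by apply: le_trans (nmB _ _) _; rewrite lerD2l.
have h1 : nm (iter n f x) <= (1 + q) ^+ n * nm x by apply: nm_iter ft; lra.
have := nmD (x - iter n f x) (iter n f x - f (iter n f x)).
rewrite addrA subrK; have := fq (iter n f x); rewrite exprS.
have := ler_wpM2l q0 h1; lra.
Qed.

(** A reverse of Bernoulli's inequality. *)
Lemma one_add_expn_le n (q : R) : 0 <= q -> n%:R * q <= 1 / 2 ->
  (1 + q) ^+ n <= 1 + 2 * (n%:R * q).
Proof.
move=> q0; elim: n => [|n IH]; first by rewrite expr0 mul0r mulr0 addr0.
rewrite -natr1 mulrDl mul1r => h; have := IH _; rewrite exprS.
have nq0 : 0 <= n%:R * q by rewrite mulr_ge0.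
move=> /(_ ltac:(lra)) h2.
apply: le_trans (ler_wpM2l _ h2) _; first lra.
by move: h nq0; set p := n%:R * q; nra.
Qed.

Lemma normal_nm (N : H -> H) x : bounded_op N -> normal_op N ->
  nm (adj N x) = nm (N x).
Proof.
move=> hN NN; apply/eqP; rewrite -(eqrXn2 (n:=2))// ?nm_ge0// -!rdot_diag.
rewrite -rdot_adj// -[N (adj N x)]/((N \o adj N) x) NN/=.
by rewrite (rdotC _ x) -rdot_adj.
Qed.

Section FixedOperators.
Variables (N M : H -> H).
Hypotheses (hN : bounded_op N) (hM : bounded_op M) (NN : normal_op N).
Hypothesis NM : N \o M = M \o N.

Let Ns := adj N.
Let a w y := y + w *: Ns y.
Let b w y := y + conjC w *: N y.

Let lN : linear N. Proof. by case: hN. Qed.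
Let lM : linear M. Proof. by case: hM. Qed.
Let hNs : bounded_op Ns. Proof. exact: adj_bounded. Qed.
Let lNs : linear Ns. Proof. by case: hNs. Qed.

Let NsN x : Ns (N x) = N (Ns x).
Proof. by rewrite -[RHS]/((N \o Ns) x) NN. Qed.

Let nm_ab w y : nm (a w y) = nm (b w y).
Proof.
apply/eqP; rewrite -(eqrXn2 (n:=2))// ?nm_ge0// -!rdot_diag /a /b.
rewrite !(sformDl rdot_sform) !(sformDr rdot_sform).
rewrite !rdot_diag !nmZ cabs_conj normal_nm//.
rewrite (rdotC (_ *: _) y) (rdotC (_ *: _) y).
suff -> : rdot y (w *: Ns y) = rdot y (conjC w *: N y) by [].
rewrite /rdot !hdotZr -(adjP hN) conjCK (hdotC (N y) y) -[RHS]Re_conj.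
by rewrite rmorphM/= conjCK.
Qed.

Let a_b w v y : a w (b v y) = b v (a w y).
Proof.
rewrite /a /b (linear_opD _ _ lNs) (linear_opD _ _ lN) (linear_opZ _ _ lNs).
rewrite (linear_opZ _ _ lN) NsN !scalerDr !scalerA mulrC.
by rewrite -!addrA; congr (_ + _); rewrite addrCA.
Qed.

Let bb w y : b w (b (- w) y) = y - (conjC w ^+ 2) *: N (N y).
Proof.
rewrite /b (linear_opD _ _ lN) (linear_opZ _ _ lN) rmorphN/= !scalerDr !scalerA !scaleNr.
by rewrite mulrN scaleNr addrA subrK expr2.
Qed.

Let b_b w v y : b w (b v y) = b v (b w y).
Proof.
rewrite /b !(linear_opD _ _ lN) !(linear_opZ _ _ lN) !scalerDr !scalerA mulrC.
by rewrite -!addrA; congr (_ + _); rewrite addrCA.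
Qed.

Let b_M w y : b w (M y) = M (b w y).
Proof.
by rewrite /b (linear_opD _ _ lM) (linear_opZ _ _ lM) -[N (M y)]/((N \o M) y) NM.
Qed.

Variable K : R.
Hypotheses (K0 : 0 <= K) (NK : forall x, nm (N x) <= K * nm x).

Let nm_bb w y : nm (y - b w (b (- w) y)) <= (cabs w * K) ^+ 2 * nm y.
Proof.
rewrite bb opprB addrC subrK nmZ cabsX cabs_conj exprMn.
rewrite -[leRHS]mulrA ler_wpM2l ?sqr_ge0//.
by apply: le_trans (NK _) _; rewrite expr2 -[leRHS]mulrA ler_wpM2l.
Qed.

Let nm_a w y : nm (a w y) <= (1 + cabs w * K) * nm y.
Proof.
apply: le_trans (nmD _ _) _; rewrite mulrDl mul1r lerD2l nmZ -[leRHS]mulrA.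
by rewrite ler_wpM2l ?cabs_ge0// normal_nm.
Qed.

Let nm_a_b w y : nm (a w (b (- w) y)) <= (1 + (cabs w * K) ^+ 2) * nm y.
Proof.
rewrite nm_ab -(subKr y (b w _)) mulrDl mul1r.
by apply: le_trans (nmB _ _) _; rewrite lerD2l.
Qed.

(** [b w] and [b (- w)] are inverse to each other up to an error quadratic in [w]. Inserting [n]
    factors of each to the right of [M], and moving those of [b (- w)] across [M], pairs every [a]
    with a [b] of opposite parameter; a pair has norm at most 1 + (|w| K)^2, which gives the first
    summand. The second pays for the insertion. *)
Let conjugate_bound L w n x : 0 <= L -> (forall x, nm (M x) <= L * nm x) ->
  nm (iter n (a w) (M (iter n (a (- w)) x))) <=
    (((1 + (cabs w * K) ^+ 2) ^+ n) ^+ 2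
     + ((1 + cabs w * K) ^+ n) ^+ 2 * ((1 + (cabs w * K) ^+ 2) ^+ n - 1)) * L * nm x.
Proof.
move=> L0 ML; set q := (cabs w * K) ^+ 2; set t := 1 + cabs w * K.
have q0 : 0 <= q by exact: sqr_ge0.
have wK : 0 <= cabs w * K by rewrite mulr_ge0// cabs_ge0.
have t0 : 0 <= t by rewrite /t; lra.
pose y := iter n (a (- w)) x.
pose B := iter n (b w \o b (- w)) y.
have -> : M (iter n (a (- w)) x) = M B + M (y - B).
  by rewrite (linear_opB _ _ lM) addrC subrK.
have aD u v : iter n (a w) (u + v) = iter n (a w) u + iter n (a w) v.
  elim: n {y B} => //= n ->; rewrite /a (linear_opD _ _ lNs) scalerDr.
  by rewrite addrACA.
rewrite aD; apply: le_trans (nmD _ _) _; rewrite 2!mulrDl; apply: lerD.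
  have -> : iter n (a w) (M B) =
      iter n (a w \o b (- w)) (M (iter n (b w \o a (- w)) x)).
    rewrite /B -iter_comp// /y -[in RHS]iter_comp; last by move=> u; rewrite a_b.
    rewrite -[in RHS]iter_comp; last by move=> u; rewrite a_b.
    congr (iter n (a w) _).
    have iM m v u : iter m (b v) (M u) = M (iter m (b v) u).
      by elim: m => //= m ->; rewrite b_M.
    rewrite iM; congr M; apply: (iter_commute (g := iter n (b (- w)))) => u.
    by rewrite iter_commute// => v; rewrite b_b.
  apply: le_trans (nm_iter n _ _ (nm_a_b w)) _; rewrite -/q; first lra.
  rewrite expr2 -![leRHS]mulrA ler_wpM2l ?exprn_ge0//; first lra.
  apply: le_trans (ML _) _; rewrite mulrCA ler_wpM2l//.
  apply: nm_iter => [|u]; first by rewrite -/q; lra.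
  by rewrite /= -a_b; have := nm_a_b (- w) u; rewrite opprK cabsN.
apply: le_trans (nm_iter n _ t0 (nm_a w)) _.
rewrite expr2 -![leRHS]mulrA ler_wpM2l ?exprn_ge0//.
apply: le_trans (ML _) _.
have h1 : nm (y - B) <= ((1 + q) ^+ n - 1) * nm y.
  exact: (nm_iter_sub n y q0 (nm_bb w)).
have h2 : nm y <= t ^+ n * nm x.
  by apply: nm_iter => // u; have := nm_a (- w) u; rewrite cabsN.
have q1 : 0 <= (1 + q) ^+ n - 1.
  by rewrite subr_ge0 exprn_ege1//; lra.
have := ler_wpM2l q1 h2 => h3.
rewrite [leRHS](_ : _ = L * (((1 + q) ^+ n - 1) * (t ^+ n * nm x))); last by ring.
by rewrite ler_wpM2l//; apply: le_trans h1 h3.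
Qed.

(* Rosenblum's argument, with [(1 + z N^* / n)^n] in place of [exp (z N^* )]:
   the factors [(1 -+ conj z N / n)^n], which commute with [M], make the
   conjugation by these almost unitary. *)
Let commutator_small (L r : R) x : 0 <= L -> (forall x, nm (M x) <= L * nm x) ->
  0 < r -> r * nm (Ns (M x) - M (Ns x)) <= 6 * L * nm x.
Proof.
move=> L0 ML r0; set u := r * K.
have u0 : 0 <= u by rewrite mulr_ge0// ltW.
(* Below, [n = P * k] and [q = (u / n) ^+ 2]. [P] makes (1 + u/n)^k at most 2, so that [E] bounds
   the square of (1 + u/n)^n for every [k]; then [k] is taken so large that
   [2 * (n * q) * E <= 1]. *)
pose P := (Num.bound (2 * u)).+1.
have uP : u / P%:R <= 1 / 2.
  rewrite ler_pdivrMr ?ltr0Sn//.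
  have : 2 * u < (Num.bound (2 * u))%:R by apply: archi_boundP; lra.
  by rewrite /P -[(Num.bound _).+1%:R]natr1; lra.
pose E : R := (2 ^+ P) ^+ 2.
have E1 : 1 <= E by rewrite !exprn_ege1//; lra.
have E0 : 0 <= E := le_trans ler01 E1.
have uE0 : 0 <= 2 * u ^+ 2 * E.
  by apply: mulr_ge0 => //; apply: mulr_ge0 => //; exact: sqr_ge0.
pose k := (Num.bound (2 * u ^+ 2 * E)).+1.
have k0 : (0 : R) < k%:R by rewrite ltr0Sn.
have uk : 2 * u ^+ 2 * E / k%:R <= 1.
  rewrite ler_pdivrMr// mul1r; apply/ltW/(lt_le_trans (archi_boundP _)).
    exact: uE0.
  by rewrite ler_nat leqnSn.
have [n nPk] : exists n, n = (P * k)%N by exists (P * k)%N.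
have P0 : (1 : R) <= P%:R by rewrite ler1n.
have nE : n%:R = P%:R * k%:R :> R by rewrite nPk natrM.
have n0 : (0 : R) < n%:R by rewrite nE mulr_gt0//; lra.
have un : 2 * u ^+ 2 * E / n%:R <= 1.
  apply: le_trans uk; rewrite ler_wpM2l//.
  by rewrite lef_pV2 ?posrE// nE ler_peMl// ltW.
have nn0 : n%:R != 0 :> R by rewrite gt_eqF.
pose s : C := (n%:R^-1)%:C.
have hp : vpoly_coef1 (fun z => iter n (a (z * s)) (M (iter n (a (- (z * s))) x)))
    (Ns (M x) - M (Ns x)).
  have ns : n%:R * s = 1.
    by rewrite /s fmorphV rmorph_nat/= divff// pnatr_eq0 -(pnatr_eq0 R).
  have h1 := vpoly_coef1_iter (- s) n lNs (vpoly_coef1_cst x).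
  have h2 := vpoly_coef1_iter s n lNs (vpoly_coef1_linear lM h1).
  have e0 : iter n (fun y => y + (0 * - s) *: Ns y) x = x.
    by elim: (n) => //= m ->; rewrite mul0r scale0r addr0.
  move: h2; rewrite /= e0 add0r mulrN ns scaleN1r scale1r (linear_opN _ lM) addrC.
  case=> m [c [fE c1]]; exists m, c; split=> // z; rewrite -fE /=.
  congr (iter n _ (M (iter n _ x))); apply/funext => y.
  by rewrite /a mulrN.
(* [5 * L] is the bound on the circle, from [Q ^+ 2 <= 4] and [t * (Q - 1) <= 1] below; the
   remaining [L] bounds the value [M x] at 0. *)
have -> : 6 * L * nm x = 5 * L * nm x + L * nm x by ring.
have f0 : iter n (a (0 * s)) (M (iter n (a (- (0 * s))) x)) = M x.
  have i0 m y : iter m (a 0) y = y.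
    by elim: m => //= m ->; rewrite /a scale0r addr0.
  by rewrite mul0r oppr0 !i0.
apply: le_trans (vpoly_cauchy1 (B := 5 * L * nm x) hp r0 _) _; last first.
  by rewrite f0 lerD2l.
move=> z zr; apply: le_trans (conjugate_bound _ _ _ L0 ML) _.
have -> : cabs (z * s) * K = u / n%:R.
  by rewrite cabsM zr cabs_real ger0_norm ?invr_ge0 ?ler0n// mulrAC.
set q := (u / n%:R) ^+ 2.
have q0 : 0 <= q by exact: sqr_ge0.
have nq : n%:R * q = u ^+ 2 / n%:R by rewrite /q; field.
have nqE : 2 * (n%:R * q) * E <= 1 by rewrite nq; move: un; lra.
have nq0 : 0 <= n%:R * q by rewrite mulr_ge0// ltW.
have nq1 : 2 * (n%:R * q) <= 1.
  by move: nqE E1 nq0; set p := n%:R * q; nra.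
have hq := one_add_expn_le q0 (n := n) ltac:(lra).
have q1 : 1 <= (1 + q) ^+ n by rewrite exprn_ege1//; lra.
have tE : ((1 + u / n%:R) ^+ n) ^+ 2 <= E.
  have t1 : 0 <= 1 + u / n%:R by have := divr_ge0 u0 (ltW n0); lra.
  rewrite ler_sqr ?nnegrE ?exprn_ge0//.
  rewrite {2}nPk mulnC exprM lerXn2r ?nnegrE ?exprn_ge0//.
  have ku : k%:R * (u / n%:R) = u / P%:R.
    by rewrite nE; field; rewrite !gt_eqF//; lra.
  have := one_add_expn_le (divr_ge0 u0 (ltW n0)) (n := k); rewrite ku => /(_ uP).
  lra.
have t0 : 0 <= ((1 + u / n%:R) ^+ n) ^+ 2 by exact: sqr_ge0.
apply: ler_wpM2r (nm_ge0 _) _ _ _; apply: ler_wpM2r => //.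
set Q := (1 + q) ^+ n in hq q1 *; set t := (_ ^+ n) ^+ 2 in tE t0 *.
have Q2 : Q ^+ 2 <= 4 by nra.
suff : t * (Q - 1) <= 1 by lra.
apply: le_trans nqE; rewrite mulrC; apply: ler_pM => //; lra.
Qed.

(** Liouville's argument: in [commutator_small] the radius [r] is arbitrary, while the right-hand
    side is independent of it. *)
Lemma fuglede_bounded : Ns \o M = M \o Ns.
Proof.
have [L L0 ML] := bounded_opP hM.
apply/funext => x /=; apply/eqP; rewrite -subr_eq0 -nm_eq0 eq_le nm_ge0 andbT.
set X := nm _; rewrite leNgt; apply/negP => X0.
have Lx : 0 <= 6 * L * nm x by rewrite !mulr_ge0 ?nm_ge0.
have := @commutator_small L ((6 * L * nm x + 1) / X) x L0 ML.
rewrite -/X divfK ?gt_eqF//; set B := 6 * L * nm x.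
suff r0 : 0 < (B + 1) / X by move=> /(_ r0); lra.
by rewrite divr_gt0// ltr_wpDl.
Qed.

End FixedOperators.

Lemma fuglede (N M : H -> H) : bounded_op N -> bounded_op M -> normal_op N ->
  N \o M = M \o N -> adj N \o M = M \o adj N.
Proof.
by move=> hN hM NN NM; have [K K0 NK] := bounded_opP hN; apply: fuglede_bounded K0 NK.
Qed.

End Fuglede.

Lemma minr_le_l (R : realType) (x y : R) : minr x y <= x.
Proof. by rewrite ge_min lexx. Qed.
Lemma minr_le_r (R : realType) (x y : R) : minr x y <= y.
Proof. by rewrite ge_min lexx orbT. Qed.

(** * Characters from joint approximate eigenvectors *)

Section ApproximateCharacters.
Context {R : realType} {H : hilbertType R} {d : nat}.
Local Notation C := R[i].
Implicit Types (x y : H) (f g : H -> H) (c : C).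

Lemma bounded_op_cstar : unital_cstar_subalgebra (@bounded_op R H).
Proof.
split=> //; first exact: bounded_op_id.
- by move=> c f g; exact: bounded_op_comb.
- by move=> f g hf hg; split; [exact: bounded_op_comp|exact: adj_bounded].
Qed.

Lemma cstar_generated_cstar (N : d.-tuple (H -> H)) :
  (forall j, bounded_op (tnth N j)) ->
  unital_cstar_subalgebra (cstar_generated N).
Proof.
move=> hN; split.
- apply: smallest_sub; first exact: bounded_op_cstar.
  by move=> _ [j _ <-].
- by move=> A [[]].
- move=> c f g hf hg A hA; have [[_ _ lin _ _] _] := hA.
  by apply: lin; [exact: hf|exact: hg].
- move=> f g hf hg; split=> A hA; have [[_ _ _ mul _] _] := hA.
    by have [] := mul f g (hf A hA) (hg A hA).
  by have [] := mul f g (hf A hA) (hg A hA).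
- move=> f bf cl A hA; have [[_ _ _ _ lim] _] := hA; apply: lim => // e e0.
  by have [g hg fg] := cl e e0; exists g => //; exact: hg.
Qed.

Lemma cstar_generated_gen (N : d.-tuple (H -> H)) j : cstar_generated N (tnth N j).
Proof. by move=> A [_]; apply; exists j. Qed.

Variables (N : d.-tuple (H -> H)) (mu : d.-tuple C).
Hypothesis hN : forall j, bounded_op (tnth N j).

Definition joint_approx (e : R) x := forall j,
  nm (tnth N j x - tnth mu j *: x) <= e * nm x /\
  nm (adj (tnth N j) x - conjC (tnth mu j) *: x) <= e * nm x.

(** [c] is the value at [f] of the character under construction. All good enough approximate
    eigenvectors are tested at once, so the value depends on no choice of a sequence of them. *)
Definition approx_scalar f c := forall e : R, 0 < e ->
  exists2 h : R, 0 < h & forall x, joint_approx h x -> nm (f x - c *: x) <= e * nm x.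

Lemma joint_approx_le (h h' : R) x : h <= h' -> joint_approx h x -> joint_approx h' x.
Proof.
move=> hh hx j; have [h1 h2] := hx j.
by split; [apply: le_trans h1 _|apply: le_trans h2 _]; rewrite ler_wpM2r ?nm_ge0.
Qed.

Lemma approx_scalar_id : approx_scalar idfun 1.
Proof.
move=> e e0; exists 1 => // x _.
by rewrite scale1r subrr nm0 mulr_ge0 ?nm_ge0// ltW.
Qed.

Lemma approx_scalar_comb a f g cf cg : approx_scalar f cf -> approx_scalar g cg ->
  approx_scalar (a *: f + g) (a * cf + cg).
Proof.
move=> hf hg e e0; pose w := cabs a + 1.
have w0 : 0 < w by have := cabs_ge0 a; rewrite /w; lra.
have [|h1 h10 H1] := hf (e / 2 / w); first by rewrite !divr_gt0.
have [|h2 h20 H2] := hg (e / 2); first by rewrite divr_gt0.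
exists (minr h1 h2); first by rewrite lt_min h10.
move=> x hx.
have l1 := H1 x (joint_approx_le (minr_le_l h1 h2) hx).
have l2 := H2 x (joint_approx_le (minr_le_r h1 h2) hx).
rewrite !op_E scalerDl -scalerA opprD addrACA -scalerBr.
apply: le_trans (nmD _ _) _; rewrite nmZ.
have aw : cabs a * nm (f x - cf *: x) <= w * (e / 2 / w * nm x).
  by apply: ler_pM; rewrite ?cabs_ge0 ?nm_ge0// /w lerDl.
have -> : e * nm x = w * (e / 2 / w * nm x) + e / 2 * nm x.
  by field; rewrite gt_eqF.
exact: lerD.
Qed.

Lemma approx_scalar_comp f g cf cg : bounded_op f ->
  approx_scalar f cf -> approx_scalar g cg -> approx_scalar (f \o g) (cf * cg).
Proof.
move=> bf hf hg e e0; have [M M0 fM] := bounded_opP bf; have [lf _] := bf.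
pose w := cabs cg + 1; have w0 : 0 < w by have := cabs_ge0 cg; rewrite /w; lra.
pose v := M + 1; have v0 : 0 < v by rewrite /v; lra.
have [|h1 h10 H1] := hf (e / 2 / w); first by rewrite !divr_gt0.
have [|h2 h20 H2] := hg (e / 2 / v); first by rewrite !divr_gt0.
exists (minr h1 h2); first by rewrite lt_min h10.
move=> x hx.
have l1 := H1 x (joint_approx_le (minr_le_l h1 h2) hx).
have l2 := H2 x (joint_approx_le (minr_le_r h1 h2) hx).
have -> : (f \o g) x - (cf * cg) *: x = f (g x - cg *: x) + cg *: (f x - cf *: x).
  rewrite /= (linear_opB _ _ lf) (linear_opZ _ _ lf) scalerBr scalerA.
  by rewrite (mulrC cg) addrA subrK.
apply: le_trans (nmD _ _) _; rewrite nmZ.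
have a1 : cabs cg * nm (f x - cf *: x) <= w * (e / 2 / w * nm x).
  by apply: ler_pM; rewrite ?cabs_ge0 ?nm_ge0// /w lerDl.
have a2 : nm (f (g x - cg *: x)) <= v * (e / 2 / v * nm x).
  apply: le_trans (fM _) _.
  by apply: ler_pM; rewrite ?nm_ge0// /v lerDl.
have -> : e * nm x = v * (e / 2 / v * nm x) + w * (e / 2 / w * nm x).
  by field; rewrite !gt_eqF.
exact: lerD.
Qed.

Lemma approx_scalar_gen j : approx_scalar (tnth N j) (tnth mu j) /\
  approx_scalar (adj (tnth N j)) (conjC (tnth mu j)).
Proof. by split=> e e0; exists e => // x /(_ j)[]. Qed.

Hypothesis mu_approx : forall e : R, 0 < e -> exists2 x, x != 0 & joint_approx e x.

(** Both relations are tested at one nonzero joint approximate eigenvector, provided by [mu_approx].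
    The estimate gives uniqueness of the scalar and makes the scalars of a convergent sequence
    Cauchy. *)
Lemma approx_scalar_close f g cf cg (e : R) :
    approx_scalar f cf -> approx_scalar g cg ->
  (forall x, nm (f x - g x) <= e * nm x) -> cabs (cf - cg) <= e.
Proof.
move=> hf hg fg; apply/ler_addgt0Pl => t t0.
have [|h1 h10 H1] := hf (t / 2); first by rewrite divr_gt0.
have [|h2 h20 H2] := hg (t / 2); first by rewrite divr_gt0.
have [|x x0 hx] := @mu_approx (minr h1 h2); first by rewrite lt_min h10.
have l1 := H1 x (joint_approx_le (minr_le_l h1 h2) hx).
have l2 := H2 x (joint_approx_le (minr_le_r h1 h2) hx).
have nx : 0 < nm x by rewrite nm_gt0.
rewrite -(ler_pM2r nx) -nmZ.
have -> : (cf - cg) *: x = (f x - g x) - (f x - cf *: x) + (g x - cg *: x).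
  by rewrite scalerBl opprB [f x - g x + _]addrC !addrA !subrK.
have := fg x; have := nmD (f x - g x - (f x - cf *: x)) (g x - cg *: x).
have := nmB (f x - g x) (f x - cf *: x); lra.
Qed.

Lemma approx_scalar_unique f c c' : approx_scalar f c -> approx_scalar f c' -> c = c'.
Proof.
move=> h h'; apply/eqP; rewrite -subr_eq0 -cabs_eq0 eq_le cabs_ge0 andbT.
by apply: (approx_scalar_close h h') => x; rewrite subrr nm0 mul0r.
Qed.

(** The intervals with centre [u n] and radius [e n] meet pairwise, so they have a common point: the
    supremum of the left ends. *)
Lemma real_limit (u e : nat -> R) :
  (forall m n, `|u m - u n| <= e m + e n) ->
  exists l, forall n, `|l - u n| <= e n.
Proof.
move=> hu; pose S := [set u n - e n | n in [set: nat]].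
have ub n : ubound S (u n + e n).
  by move=> _ [m _ <-]; have := hu m n; rewrite ler_norml; lra.
have hS : has_sup S by split; [exists (u 0%N - e 0%N); exists 0%N|exists (u 0%N + e 0%N)].
exists (sup S) => n.
have h1 : sup S <= u n + e n by apply: ge_sup => //; case: hS.
have h2 : u n - e n <= sup S by apply: (ub_le_sup (proj2 hS)); exists n.
by rewrite ler_norml; lra.
Qed.

Lemma approx_scalar_limit (f : H -> H) (g : nat -> H -> H) (c : nat -> C) :
    (forall n x, nm (f x - g n x) <= n.+1%:R^-1 * nm x) ->
    (forall n, approx_scalar (g n) (c n)) ->
  exists l, forall n, cabs (l - c n) <= 2 * n.+1%:R^-1.
Proof.
move=> fg gc; pose e n : R := n.+1%:R^-1.
have cc m n : cabs (c m - c n) <= e m + e n.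
  apply: (approx_scalar_close (gc m) (gc n)) => x; rewrite mulrDl.
  have -> : g m x - g n x = (f x - g n x) - (f x - g m x).
    by rewrite opprB [RHS]addrC !addrA subrK.
  by apply: le_trans (nmB _ _) _; rewrite addrC lerD ?fg.
have [a ha] : exists a, forall n, `|a - Re (c n)| <= e n.
  apply: real_limit => m n; apply: le_trans (cc m n).
  by rewrite -ReN -ReD Re_le_cabs.
have [b hb] : exists b, forall n, `|b - Im (c n)| <= e n.
  apply: real_limit => m n; apply: le_trans (cc m n).
  by rewrite -ImN -ImD Im_le_cabs.
exists (a +i* b) => n; apply: le_trans (cabs_le_ReIm _) _.
by rewrite ReD ReN ImD ImN mulr_natl mulr2n lerD.
Qed.

Lemma approx_scalar_of_limit (f : H -> H) (g : nat -> H -> H) (c : nat -> C) l :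
    (forall n x, nm (f x - g n x) <= n.+1%:R^-1 * nm x) ->
    (forall n, approx_scalar (g n) (c n)) ->
    (forall n, cabs (l - c n) <= 2 * n.+1%:R^-1) ->
  approx_scalar f l.
Proof.
move=> fg gc lc e e0; pose n := Num.bound (4 / e).
have ne : n.+1%:R^-1 <= e / 4.
  rewrite -[e / 4]invrK lef_pV2 ?posrE ?invr_gt0 ?divr_gt0 ?ltr0Sn// invf_div.
  apply/ltW/(lt_le_trans (archi_boundP _)); first by rewrite divr_ge0// ltW.
  by rewrite ler_nat leqnSn.
have [|h h0 Hh] := gc n (e / 4); first by rewrite divr_gt0.
exists h => // x /Hh l1.
have -> : f x - l *: x = (f x - g n x) + (g n x - c n *: x) - (l - c n) *: x.
  by rewrite scalerBl opprB !addrA !subrK.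
move: ne (fg n x) (lc n); move: (n.+1%:R^-1) => v ne fgn lcn.
have := ler_wpM2r (nm_ge0 x) lcn; rewrite -nmZ.
have := ler_wpM2r (nm_ge0 x) ne.
have := nmD (f x - g n x) (g n x - c n *: x).
have := nmB ((f x - g n x) + (g n x - c n *: x)) ((l - c n) *: x); lra.
Qed.

(** The clause on [adj f] makes the set closed under adjoints. *)
Definition scalar_alg : set (H -> H) := [set f | bounded_op f /\
  exists2 c, approx_scalar f c & approx_scalar (adj f) (conjC c)].

Lemma scalar_alg_cstar : unital_cstar_subalgebra scalar_alg.
Proof.
split.
- by move=> f [].
- split; first exact: bounded_op_id.
  by exists 1; rewrite ?adj_id ?conjC1; exact: approx_scalar_id.
- move=> a f g [bf [cf h1 h2]] [bg [cg h3 h4]]; split; first exact: bounded_op_comb.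
  exists (a * cf + cg); first exact: approx_scalar_comb.
  by rewrite adj_comb// rmorphD rmorphM; exact: approx_scalar_comb.
- move=> f g [bf [cf h1 h2]] [bg [cg h3 h4]]; split; split.
  + exact: bounded_op_comp.
  + exists (cf * cg); first exact: approx_scalar_comp.
    rewrite adj_comp// rmorphM mulrC; apply: approx_scalar_comp => //.
    exact: adj_bounded.
  + exact: adj_bounded.
  + by exists (conjC cf); rewrite ?adjK ?conjCK.
move=> f bf cl.
have ex (n : nat) : exists gc : (H -> H) * C, [/\ bounded_op gc.1,
    forall x, nm (f x - gc.1 x) <= n.+1%:R^-1 * nm x,
    approx_scalar gc.1 gc.2 & approx_scalar (adj gc.1) (conjC gc.2)].
  have [|g [bg [c hc hc']] fg] := cl n.+1%:R^-1; first by rewrite invr_gt0 ltr0Sn.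
  exists (g, c); split=> // x.
  by have := fg x; rewrite !normE -rmorphM/= lecR.
have [gc hgc] := choice ex.
have fg n x : nm (f x - (gc n).1 x) <= n.+1%:R^-1 * nm x by case: (hgc n).
have ga n : approx_scalar (gc n).1 (gc n).2 by case: (hgc n).
have [l hl] := approx_scalar_limit fg ga.
split=> //; exists l; first exact: approx_scalar_of_limit fg ga hl.
apply: (@approx_scalar_of_limit _ (fun n => adj (gc n).1) (fun n => conjC (gc n).2)).
- move=> n x; have [bg fgn _ _] := hgc n.
  have -> : adj f x - adj (gc n).1 x = adj (- 1 *: (gc n).1 + f) x.
    by rewrite adj_comb// !op_E rmorphN1 scaleN1r addrC.
  apply: nm_adj_le => [||y]; first exact: bounded_op_comb.
    by rewrite invr_ge0.
  by rewrite !op_E scaleN1r addrC.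
- by move=> n; case: (hgc n).
- by move=> n; rewrite -rmorphB cabs_conj.
Qed.

(** [scalar_alg] is a C*-algebra containing the generators, so it contains [cstar_generated N], and
    on it the unique approximate scalar is linear and multiplicative. *)
Lemma approx_gelfand : gelfand_spectrum N mu.
Proof.
pose pi f := xget 0 [set c | approx_scalar f c].
have piE f c : approx_scalar f c -> pi f = c.
  by move=> fc; apply: xget_unique => // c' /= fc'; exact: approx_scalar_unique fc' fc.
have sub : cstar_generated N `<=` scalar_alg.
  apply: smallest_sub; first exact: scalar_alg_cstar.
  move=> _ [j _ <-]; split=> //.
  by have [h1 h2] := approx_scalar_gen j; exists (tnth mu j).
exists pi; last by move=> j; rewrite (piE _ (tnth mu j))//; case: (approx_scalar_gen j).
split.
- by apply: piE; exact: approx_scalar_id.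
- move=> c f g /sub[bf [cf hf _]] /sub[bg [cg hg _]].
  by rewrite (piE f cf)// (piE g cg)//; apply: piE; exact: approx_scalar_comb.
- move=> f g /sub[bf [cf hf _]] /sub[bg [cg hg _]].
  by rewrite (piE f cf)// (piE g cg)//; apply: piE; exact: approx_scalar_comp.
Qed.

End ApproximateCharacters.

(** * Uniform boundedness *)

Section UniformBoundedness.
Context {R : realType} {H : hilbertType R}.
Local Notation C := R[i].
Implicit Types (x y : H).

(* A gliding hump argument: were the conclusion false, unit vectors [u_n] with
   [E u_n] tiny would make [y = sum_n +- u_n / 3 ^ n] violate the hypothesis. *)
Lemma weakly_dominated_below (E : H -> R) :
    (forall x, 0 <= E x) -> (forall (c : C) x, E (c *: x) = cabs c * E x) ->
    (forall y, exists M, forall x, rdot x y <= M * E x) ->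
  exists2 M : R, 0 < M & forall x, nm x <= M * E x.
Proof.
move=> E0 EZ Ew; apply: contrapT => /forall2NP noM.
pose t n : R := 3^-1 ^+ n.
have t0 n : 0 < t n by rewrite exprn_gt0// invr_gt0.
have tS n : t n = 3 * t n.+1 by rewrite /t exprS; field.
(* The factor 4 prepares the contradiction: half of the [n]-th hump survives in the limit, and for
   large [n] this gives [t n / 2 <= n.+1 * E (u n) < t n / 4]. *)
have ex n : exists u, nm u = 1 /\ 4 * n.+1%:R * E u < t n.
  pose M := 4 * n.+1%:R / t n.
  have M0 : 0 < M by rewrite divr_gt0// mulr_gt0.
  have [//|/existsNP[x /negP]] := noM M; rewrite -ltNge => xM.
  have x0 : 0 < nm x by apply: le_lt_trans xM; rewrite mulr_ge0// ltW.
  exists ((nm x)^-1%:C *: x); rewrite nmZ EZ cabs_real ger0_norm ?invr_ge0 ?nm_ge0//.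
  split; first by rewrite mulVf// gt_eqF.
  rewrite mulrCA mulrC ltr_pdivrMr//.
  suff -> : 4 * n.+1%:R * E x = t n * (M * E x) by rewrite ltr_pM2l.
  by rewrite mulrA /M [t n * _]mulrC divfK// gt_eqF.
have [u hu] := choice ex.
(* The sign is that of the pairing already reached, so the new term adds to it instead of cancelling
   it. *)
pose step n y : H := y + ((if 0 <= rdot (u n) y then t n else - t n)%:C *: u n).
pose Y := fix Y n : H := if n is k.+1 then step k (Y k) else 0.
have uu n : rdot (u n) (u n) = 1 by rewrite rdot_diag (proj1 (hu n)) expr1n.
have hump n : t n <= `|rdot (u n) (Y n.+1)|.
  rewrite /= /step (sformDr rdot_sform) (sformZr rdot_sform) uu mulr1.
  case: ifPn => [h|]; first by rewrite ger0_norm ?lerDr// addr_ge0// ltW.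
  rewrite -ltNge => h; rewrite ltr0_norm ?opprD ?opprK ?lerDr ?oppr_ge0 ?ltW//.
  by have := t0 n; lra.
have dist n k : nm (Y (n + k)%N - Y n) <= 3 / 2 * (t n - t (n + k)%N).
  elim: k => [|k IH]; first by rewrite addn0 !subrr nm0 mulr0.
  rewrite addnS /= /step; set v := (_ *: _).
  have -> : Y (n + k)%N + v - Y n = Y (n + k)%N - Y n + v by rewrite addrAC.
  apply: le_trans (nmD _ _) _.
  have -> : nm v = t (n + k)%N.
    rewrite /v nmZ (proj1 (hu _)) mulr1 cabs_real.
    by case: ifP => _; rewrite ?normrN ger0_norm// ltW.
  by have := tS (n + k)%N; lra.
have dist' n m : (n <= m)%N -> nm (Y m - Y n) <= 3 / 2 * t n.
  move=> nm; have := dist n (m - n)%N; rewrite subnKC//.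
  by have := t0 m; lra.
have small (e : R) : 0 < e -> exists N, t N < e.
  move=> e0; have ie : 0 < e^-1 by rewrite invr_gt0.
  exists (Num.bound e^-1); rewrite /t exprVn.
  rewrite -[X in _ < X]invrK ltf_pV2 ?posrE ?exprn_gt0//.
  apply: lt_le_trans (archi_boundP (ltW ie)) _.
  by rewrite -natrX ler_nat; exact/ltnW/ltn_expl.
have [|y hy] := @hilbert_complete _ _ Y.
  move=> e e0; have [|N hN] := small (e / 3); first by rewrite divr_gt0.
  exists N => m n Nm Nn.
  have -> : Y m - Y n = (Y m - Y N) - (Y n - Y N) by rewrite opprB addrA subrK.
  apply: le_trans (nmB _ _) _.
  by have := dist' _ _ Nm; have := dist' _ _ Nn; lra.
(* The ratio 3 pays off: all later steps together move [Y] by at most [3 / 2 * t n.+1 = t n / 2],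
   half of the hump. *)
have ylim n : nm (y - Y n.+1) <= t n / 2.
  apply/ler_addgt0Pl => e /hy[N hN].
  have h1 := hN (maxn N n.+1) (leq_maxl _ _).
  have h2 := dist' n.+1 (maxn N n.+1) (leq_maxr _ _).
  have -> : y - Y n.+1 = - (Y (maxn N n.+1) - y) + (Y (maxn N n.+1) - Y n.+1).
    by rewrite opprB addrA subrK.
  apply: le_trans (nmD _ _) _; rewrite nmN; have := tS n; lra.
have [M hM] := Ew y.
pose n := Num.bound `|M|.
have Mn : `|M| < n%:R by apply: archi_boundP.
have hM' : `|rdot (u n) y| <= M * E (u n).
  rewrite ler_norml hM andbT lerNl -(sformNl rdot_sform).
  have := hM (- u n); rewrite -[- u n]scaleN1r EZ cabsN cabs1 mul1r.
  by rewrite scaleN1r.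
have h1 : t n / 2 <= `|rdot (u n) y|.
  have : `|rdot (u n) (Y n.+1 - y)| <= t n / 2.
    apply: le_trans (Re_le_cabs _) (le_trans (hdot_le _ _) _).
    by rewrite (proj1 (hu n)) mul1r nm_distC.
  rewrite (sformDr rdot_sform) (sformNr rdot_sform).
  have := ler_dist_dist (rdot (u n) (Y n.+1)) (rdot (u n) y).
  have := ler_norm (`|rdot (u n) (Y n.+1)| - `|rdot (u n) y|).
  by have := hump n; lra.
have [_ h2] := hu n; have Eu := E0 (u n); have tn := t0 n.
have h3 : M * E (u n) <= n.+1%:R * E (u n).
  rewrite ler_wpM2r//; apply: le_trans (ler_norm M) (le_trans (ltW Mn) _).
  by rewrite ler_nat.
lra.
Qed.

End UniformBoundedness.

(** * The Gelfand spectrum lies in the Taylor spectrum *)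

Section GelfandTaylor.
Context {R : realType} {H : hilbertType R} {d : nat}.
Local Notation C := R[i].
Implicit Types (x y : H).

(** The inverse [G] of [P] lies in [A], as the norm limit of the Neumann sums [S n] of t (1 - t
    P)^k; then [pi G * pi P = 1]. The limit follows from [G - S n = G \o Q ^ n] with [Q = 1 - t P] a
    strict contraction. *)
Lemma unital_hom_coercive (A : set (H -> H)) pi (P : H -> H) (e : R) :
    unital_cstar_subalgebra A -> unital_hom_on A pi -> A P -> 0 < e ->
    (forall x, e * nm x ^+ 2 <= rdot (P x) x) -> pi P != 0.
Proof.
move=> [Ab A1 Alin Amul Acl] [pi1 pilin pimul] AP e0 Pe.
have bP := Ab _ AP; have [lP _] := bP; have [K K0 PK] := bounded_opP bP.
have [G bG [PG GP]] := coercive_inverse bP e0 Pe.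
have [L L0 GL] := bounded_opP bG; have [lG _] := bG.
suff AG : A G.
  apply: contraTneq isT => p0.
  have : pi (G \o P) = 1.
    by rewrite (_ : G \o P = idfun)//; apply/funext => x; exact: GP.
  by rewrite pimul// p0 mulr0 => /eqP; rewrite eq_sym oner_eq0.
(* With [t * K ^+ 2 <= e], expanding the square of [nm (Q x)] gives the factor 1 - 2 t e + t^2 K^2,
   at most 1 - t e. *)
pose t := e / (K ^+ 2 + 1).
have K1 : 0 < K ^+ 2 + 1 by have := sqr_ge0 K; lra.
have t0 : 0 < t by rewrite divr_gt0.
have tK : t * (K ^+ 2 + 1) = e by rewrite /t divfK// gt_eqF.
pose Q x := x - t%:C *: P x.
have lQ : linear Q.
  move=> c x y; rewrite /Q lP scalerDr opprD addrACA scalerBr !scalerA.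
  by rewrite (mulrC c).
pose th := `|1 - t * e|.
have th0 : 0 <= th by exact: normr_ge0.
have AQ : A Q.
  suff -> : Q = - t%:C *: P + idfun by exact: Alin.
  by apply/funext => x; rewrite !op_E scaleNr addrC.
have Qth x : nm (Q x) ^+ 2 <= th * nm x ^+ 2.
  apply: le_trans (ler_wpM2r (sqr_ge0 _) (ler_norm _)).
  rewrite -rdot_diag /Q !(sformE rdot_sform) rdot_diag (rdotC x (P x)) rdot_diag.
  have h1 : nm (P x) ^+ 2 <= K ^+ 2 * nm x ^+ 2.
    by rewrite -exprMn ler_sqr ?nnegrE ?nm_ge0// mulr_ge0// nm_ge0.
  have h2 := ler_wpM2l (ltW t0) h1.
  have h3 := Pe x; have h4 := sqr_ge0 (nm x).
  have h5 : t * (t * nm (P x) ^+ 2) <= t * (e * nm x ^+ 2).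
    apply: ler_wpM2l; first exact: ltW.
    by apply: le_trans h2 _; have := mulr_ge0 (ltW t0) h4; rewrite -tK; lra.
  have h6 := ler_wpM2l (ltW t0) h3.
  move: h5 h6; lra.
(* On a nonzero space coercivity forces [e <= K], hence [t * e <= 1]. The zero space puts no limit
   on [e] and is treated apart: there any element of [A] approximates [G]. *)
have th1 : th < 1 \/ forall x, x = 0.
  have [[x x0]|all0] := pselect (exists x, x != 0); last first.
    by right=> x; apply/eqP; apply: contrapT => /negP x0; apply: all0; exists x.
  left; have nx : 0 < nm x ^+ 2 by rewrite exprn_gt0// nm_gt0.
  have te : t * e < 2.
    suff : t * e <= 1 by lra.
    have eK : e <= K.
      have [lx|] := leP e K; first by [].
      have := Pe x; have := rdot_le (P x) x; have := PK x; rewrite -nm_gt0 in x0.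
      nra.
    rewrite -(ler_pM2r K1) mulrAC tK mul1r; nra.
  rewrite ltr_norml; have := mulr_gt0 t0 e0; lra.
have nQ n x : nm (iter n Q x) ^+ 2 <= th ^+ n * nm x ^+ 2.
  elim: n => [|n IH] /=; first by rewrite mul1r.
  by apply: le_trans (Qth _) _; rewrite (exprS th n) -[leRHS]mulrA ler_wpM2l.
pose S := fix S n : H -> H := if n is k.+1 then t%:C *: idfun + (Q \o S k) else 0.
have A0 : A 0.
  suff -> : (0 : H -> H) = - 1 *: idfun + idfun by exact: Alin.
  by apply/funext => x; rewrite !op_E scaleN1r addNr.
have AS n : A (S n).
  by elim: n => [|n IH] //=; apply: Alin => //; case: (Amul Q (S n)).
have PQ x : P (Q x) = Q (P x) by rewrite /Q (linear_opB _ _ lP) (linear_opZ _ _ lP).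
have PS n x : P (S n x) = x - iter n Q x.
  elim: n => [|n IH] /=; first by rewrite op_E (linear_op0 lP) subrr.
  rewrite !op_E (linear_opD _ _ lP) (linear_opZ _ _ lP) PQ IH (linear_opB _ _ lQ).
  by rewrite addrA; congr (_ - _); rewrite /Q /= addrC subrK.
have GS n x : G x - S n x = G (iter n Q x).
  by rewrite -[S n x]GP PS (linear_opB _ _ lG) subKr.
apply: Acl => // s s0.
case: th1 => [th1|all0]; last first.
  by exists P => // x; rewrite (all0 (_ - _)) normr0 mulr_ge0// ltW// ltcR.
pose g := s / (L + 1).
have g0 : 0 < g by rewrite divr_gt0//; lra.
have [n hn] : exists n, th ^+ n <= g ^+ 2.
  have : th ^+ n @[n --> \oo] --> 0 by apply: cvg_expr; rewrite ger0_norm.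
  move=> /cvgrPdist_le/(_ (g ^+ 2)); rewrite exprn_gt0// => /(_ isT)[N _ hN].
  by exists N; have := hN N (leqnn N); rewrite /= sub0r normrN ger0_norm// exprn_ge0.
exists (S n); first exact: AS.
move=> x; rewrite !normE -rmorphM/= lecR GS.
have h1 : nm (iter n Q x) <= g * nm x.
  apply: ler_of_sqr; first by rewrite mulr_ge0 ?nm_ge0// ltW.
  by rewrite exprMn; apply: le_trans (nQ n x) _; rewrite ler_wpM2r// sqr_ge0.
apply: le_trans (GL _) _; apply: le_trans (ler_wpM2l L0 h1) _.
rewrite mulrA ler_wpM2r ?nm_ge0// /g mulrCA ger_pMr// ler_pdivrMr; lra.
Qed.

Lemma gelfand_sub_taylor (N : d.-tuple (H -> H)) :
  (forall j, bounded_op (tnth N j)) -> gelfand_spectrum N `<=` taylor_spectrum N.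
Proof.
move=> hN lam [pi hpi lampi] exact0.
have hA := cstar_generated_cstar hN; have [Ab A1 Alin Amul _] := hA.
have [pi1 pilin pimul] := hpi.
set A := cstar_generated N in hA Ab A1 Alin Amul hpi pilin pimul.
pose M j := tnth (tuple_shift N lam) j.
have ME j : M j = - tnth lam j *: idfun + tnth N j.
  by rewrite /M tnth_mktuple; apply/funext => x; rewrite !op_E scaleNr addrC.
have AN j : A (tnth N j) by exact: cstar_generated_gen.
have AM j : A (M j) by rewrite ME; exact: Alin.
have bM j : bounded_op (M j) by exact: Ab.
have lM j : linear (M j) by case: (bM j).
have piM j : pi (M j) = 0 by rewrite ME pilin// pi1 mulr1 -lampi addNr.
(* Exactness in degree 0: the chain with value [y] at the empty set is a cycle, hence a boundary,
   and the [z j] are the values of a preimage at singletons. *)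
have surj y : exists z : 'I_d -> H, y = \sum_j M j (z j).
  pose xi : {ffun {set 'I_d} -> H} := [ffun S => if S == finset.set0 then y else 0].
  have hxi : koszul_chain 0 xi /\ koszul_bd (tuple_shift N lam) xi = 0.
    split=> [S|]; first by rewrite cards_eq0 ffunE => /negPf->.
    apply/ffunP => S; rewrite !ffunE big1// => j _; rewrite ffunE.
    rewrite ifF -/(M j) ?(linear_op0 (lM j)) ?scaler0//.
    by apply/negbTE/negP => /eqP/setP/(_ j); rewrite !inE eqxx.
  have : [set xi | koszul_chain 0 xi /\ koszul_bd (tuple_shift N lam) xi = 0] xi by [].
  rewrite exact0 => -[eta _ /ffunP/(_ finset.set0)].
  rewrite koszul_bdE ffunE eqxx => <-.
  exists (fun j => eta (j |: finset.set0)%SET).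
  rewrite big_mkcond/=; apply: eq_bigr => j _; rewrite finset.in_set0 /=.
  by rewrite koszul_sign0 scale1r.
pose q x := \sum_j nm (adj (M j) x) ^+ 2.
have q0 x : 0 <= q x by apply: sumr_ge0 => j _; exact: sqr_ge0.
(* The norm of the column of the [adj (M j) x]. Writing [y] as in [surj] bounds [rdot x y] by [E x]
   times the sum of the [nm (z j)]. *)
pose E x := Num.sqrt (q x).
have [| |y|B B0 hB] := @weakly_dominated_below _ _ E.
- by move=> x; exact: sqrtr_ge0.
- move=> c x; rewrite /E -[cabs c]ger0_norm ?cabs_ge0// -sqrtr_sqr -sqrtrM ?sqr_ge0//.
  congr Num.sqrt; rewrite mulr_sumr; apply: eq_bigr => j _.
  by rewrite (linear_opZ _ _ (proj1 (adj_bounded (bM j)))) nmZ exprMn.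
- have [z ->] := surj y; exists (\sum_j nm (z j)) => x.
  rewrite mulr_suml /rdot hdot_sumr Re_sum; apply: ler_sum => j _.
  rewrite -/(rdot x (M j (z j))) rdotC rdot_adj// rdotC mulrC.
  apply: le_trans (rdot_le _ _) _; rewrite ler_wpM2r ?nm_ge0//.
  apply: ler_of_sqr; first exact: sqrtr_ge0.
  by rewrite sqr_sqrtr// /q (bigD1 j)//= lerDl sumr_ge0// => k _; exact: sqr_ge0.
pose P : H -> H := \sum_j (M j \o adj (M j)).
have [AP pP] : A P /\ pi P = 0.
  have pi00 : A 0 /\ pi 0 = 0.
    have e0 : (0 : H -> H) = - 1 *: idfun + idfun.
      by apply/funext => x; rewrite !op_E scaleN1r addNr.
    split; first by rewrite e0; exact: Alin.
    by rewrite e0 pilin// mulN1r addNr.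
  rewrite /P; elim/big_rec: _ => [|j f _ [Af pf]]; first exact: pi00.
  have [_ AMs] := Amul (M j) (M j) (AM j) (AM j).
  have [AMM _] := Amul (M j) (adj (M j)) (AM j) AMs.
  rewrite -[_ \o _]scale1r; split; first exact: Alin.
  by rewrite pilin// pimul// piM mul0r mulr0 add0r.
have PE x : rdot (P x) x = q x.
  rewrite /P fct_sumE /rdot hdot_suml Re_sum; apply: eq_bigr => j _.
  by rewrite -/(rdot _ x) /= rdot_adj// rdot_diag.
suff : pi P != 0 by rewrite pP eqxx.
apply: (unital_hom_coercive (e := B ^- 2) hA hpi AP); first by rewrite invr_gt0 exprn_gt0.
move=> x; rewrite PE ler_pdivrMl ?exprn_gt0//.
have : nm x ^+ 2 <= (B * E x) ^+ 2.
  by rewrite ler_sqr ?nnegrE ?nm_ge0// mulr_ge0 ?sqrtr_ge0 ?ltW.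
by rewrite exprMn sqr_sqrtr.
Qed.

End GelfandTaylor.

(** * Toeplitz quadratic forms, the numerical radius and the Taylor spectrum *)

Section ToeplitzForms.
Context {R : realType} {H : hilbertType R} {d : nat}.
Local Notation C := R[i].
Implicit Types (T N : d.-tuple (H -> H)) (lam : d.-tuple C) (a : R) (v : 'cV[C]_d.+1).

(** Reduces an entrywise relation between two Toeplitz matrices to the diagonal and the two tuples,
    settling once the range of the truncated subtractions. *)
Lemma toeplitz_ind (E F : nmodType) (P : E -> F -> Prop) (a : E) (b : F)
    (low upp : d.-tuple E) (low' upp' : d.-tuple F) :
    P a b -> (forall k, P (tnth low k) (tnth low' k)) ->
    (forall k, P (tnth upp k) (tnth upp' k)) ->
  forall i j, P (toeplitz a low upp i j) (toeplitz b low' upp' i j).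
Proof.
move=> Pab Pl Pu i j; rewrite !mxE.
have lt_d (k l : 'I_d.+1) : (l < k)%N -> ((k - l).-1 < d)%N.
  by move=> lk; have := ltn_ord k; lia.
case: ifP => [ji|_].
  by have := Pl (Ordinal (lt_d _ _ ji)); rewrite !(tnth_nth 0).
case: ifP => [ij|_] //.
by have := Pu (Ordinal (lt_d _ _ ij)); rewrite !(tnth_nth 0).
Qed.

(** Indicators replace the case split: the tuple entry of index [k], counted from 0, sits on the
    diagonal at distance [k.+1] from the main one. *)
Lemma toeplitzE (a : C) (low upp : d.-tuple C) i j :
  toeplitz a low upp i j = (i == j)%:R * a
    + \sum_(k < d) (j + k.+1 == i)%N%:R * tnth low k
    + \sum_(k < d) (i + k.+1 == j)%N%:R * tnth upp k.
Proof.
have sum_lt (k l : 'I_d.+1) (t : d.-tuple C) : (l < k)%N ->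
    \sum_(m < d) (l + m.+1 == k)%N%:R * tnth t m = t`_(k - l).-1.
  move=> lk; have hm : ((k - l).-1 < d)%N by have := ltn_ord k; lia.
  rewrite (bigD1 (Ordinal hm))//= big1 ?addr0.
    rewrite (_ : (_ == _) = true) ?mul1r ?(tnth_nth 0)//; apply/eqP; lia.
  move=> m; rewrite -val_eqE/= => mk.
  rewrite (_ : (_ == _) = false) ?mul0r//; apply/negbTE; move: mk; lia.
have sum_ge (k l : 'I_d.+1) (t : d.-tuple C) : (k <= l)%N ->
    \sum_(m < d) (l + m.+1 == k)%N%:R * tnth t m = 0.
  move=> kl; rewrite big1// => m _.
  by rewrite (_ : (_ == _) = false) ?mul0r//; apply/negbTE; lia.
rewrite mxE -val_eqE; case: (ltngtP j i) => ij.
- by rewrite mul0r add0r (sum_ge j i) ?addr0 ?(sum_lt i j)// ltnW.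
- by rewrite mul0r add0r (sum_ge i j) ?add0r ?(sum_lt j i)// ltnW.
- by rewrite mul1r !sum_ge ?ij// !addr0.
Qed.

(** The autocorrelation of [v] at lag [k.+1], as a double sum so that no shifted index has to be
    shown in range. *)
Definition autocorr v (k : 'I_d) : C :=
  \sum_(i < d.+1) \sum_(j < d.+1) (j + k.+1 == i)%N%:R * (conjC (v i 0) * v j 0).

Definition energy v : R := \sum_i cabs (v i 0) ^+ 2.

Lemma quad_formE n (A : 'M[C]_n) (v : 'cV[C]_n) :
  (map_mx conjC v^T *m A *m v) 0 0 = \sum_i \sum_j conjC (v i 0) * v j 0 * A i j.
Proof.
rewrite mxE exchange_big/=; apply: eq_bigr => j _; rewrite mxE mulr_suml.
by apply: eq_bigr => i _; rewrite !mxE mulrAC.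
Qed.

Lemma toeplitz_form (a : C) (low upp : d.-tuple C) v :
  (map_mx conjC v^T *m toeplitz a low upp *m v) 0 0 =
  (energy v)%:C * a + \sum_k autocorr v k * tnth low k
    + \sum_k conjC (autocorr v k) * tnth upp k.
Proof.
rewrite quad_formE.
pose w (i j : 'I_d.+1) := conjC (v i 0) * v j 0.
pose L (i j : 'I_d.+1) := w i j * \sum_(k < d) (j + k.+1 == i)%N%:R * tnth low k.
pose U (i j : 'I_d.+1) := w i j * \sum_(k < d) (i + k.+1 == j)%N%:R * tnth upp k.
have -> : \sum_i \sum_j conjC (v i 0) * v j 0 * toeplitz a low upp i j =
    \sum_i \sum_j w i j * ((i == j)%:R * a) + \sum_i \sum_j L i j
    + \sum_i \sum_j U i j.
  rewrite -!big_split/=; apply: eq_bigr => i _.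
  rewrite -!big_split/=; apply: eq_bigr => j _.
  by rewrite toeplitzE !mulrDr.
congr (_ + _ + _).
- rewrite /energy rmorph_sum/= mulr_suml; apply: eq_bigr => i _.
  rewrite (bigD1 i)//= big1 ?addr0.
    by rewrite eqxx mul1r /w mulrC [conjC _ * _]mulrC mul_conj mulrC.
  by move=> j; rewrite eq_sym => /negPf->; rewrite mul0r mulr0.
- rewrite (eq_bigr (fun k : 'I_d => \sum_(i < d.+1) \sum_(j < d.+1)
      (j + k.+1 == i)%N%:R * w i j * tnth low k)); last first.
    by move=> k _; rewrite mulr_suml; apply: eq_bigr => i _; rewrite mulr_suml.
  rewrite [RHS]exchange_big/=; apply: eq_bigr => i _.
  rewrite [RHS]exchange_big/=; apply: eq_bigr => j _.
  by rewrite /L mulr_sumr; apply: eq_bigr => k _; ring.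
- rewrite (eq_bigr (fun k : 'I_d => \sum_(i < d.+1) \sum_(j < d.+1)
      (j + k.+1 == i)%N%:R * w j i * tnth upp k)); last first.
    move=> k _; rewrite rmorph_sum mulr_suml; apply: eq_bigr => i _.
    rewrite rmorph_sum mulr_suml; apply: eq_bigr => j _.
    by rewrite !rmorphM/= conjCK rmorph_nat /w (mulrC (v i 0)).
  rewrite exchange_big/= [RHS]exchange_big/=; apply: eq_bigr => i _.
  rewrite [RHS]exchange_big/=; apply: eq_bigr => j _.
  by rewrite /U mulr_sumr; apply: eq_bigr => k _; ring.
Qed.

Definition toeplitz_val a lam v : R :=
  energy v * a + 2 * Re (\sum_k autocorr v k * tnth lam k).

Lemma toeplitz_pt_form a lam v :
  (map_mx conjC v^T *m toeplitz_pt a lam *m v) 0 0 = (toeplitz_val a lam v)%:C.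
Proof.
rewrite /toeplitz_pt toeplitz_form /toeplitz_val -addrA rmorphD rmorphM/=.
congr (_ + _).
have -> : \sum_k conjC (autocorr v k) * tnth (map_tuple conjC lam) k =
    conjC (\sum_k autocorr v k * tnth lam k).
  by rewrite rmorph_sum; apply: eq_bigr => k _; rewrite tnth_map rmorphM.
set S := \sum_k _; apply: complex_ext; rewrite ?ReD ?ImD ?Re_conj ?Im_conj/=.
  by rewrite mulr_natl mulr2n.
by rewrite subrr.
Qed.

Lemma psd_toeplitz_pt a lam :
  psdmx (toeplitz_pt a lam) <-> forall v, 0 <= toeplitz_val a lam v.
Proof.
split=> h v; have := h v; first by rewrite toeplitz_pt_form ler0c.
by rewrite toeplitz_pt_form ler0c.
Qed.

Definition vector_states T (xi : H) : d.-tuple C := map_tuple (fun A => hdot (A xi) xi) T.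

Lemma toeplitz_vecE a T xi : (forall j, bounded_op (tnth T j)) ->
  toeplitz_vec a T xi = toeplitz_pt a (vector_states T xi).
Proof.
move=> hT; apply/matrixP => i j; apply: toeplitz_ind => // k.
by rewrite !tnth_map hdotC -(adjP (hT k)).
Qed.

Lemma toeplitz_op_bounded a T i j : (forall j, bounded_op (tnth T j)) ->
  bounded_op (toeplitz_op a T i j).
Proof.
move=> hT; apply: (@toeplitz_ind _ _ (fun A _ => bounded_op A) _ 0 _ _ T T).
- by apply: bounded_opZ; exact: bounded_op_id.
- by [].
- by move=> k; rewrite tnth_map; exact: adj_bounded.
Qed.

Lemma positive_op_num a T : (forall j, bounded_op (tnth T j)) ->
  positive_opmx (toeplitz_op a T) ->
  forall xi, `|xi| = 1 -> psdmx (toeplitz_vec a T xi).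
Proof.
move=> hT pos xi xi1 v; have := pos (fun i => v i 0 *: xi).
rewrite quad_formE; congr (0 <= _); apply: eq_bigr => i _.
rewrite hdot_suml; apply: eq_bigr => j _.
rewrite (linear_opZ _ _ (proj1 (toeplitz_op_bounded a i j hT))) hdotZl hdotZr mulrCA mulrA.
congr (_ * _); apply: (@toeplitz_ind _ _ (fun A c => hdot (A xi) xi = c)).
- by rewrite opZ_E hdotZl -hdotE xi1 expr1n mulr1.
- by move=> k; rewrite tnth_map.
- by move=> k; rewrite !tnth_map.
Qed.

Lemma num_sub_taylor a T : (forall j, bounded_op (tnth T j)) -> commuting T ->
    (forall xi, `|xi| = 1 -> psdmx (toeplitz_vec a T xi)) ->
  forall lam, taylor_spectrum T lam -> psdmx (toeplitz_pt a lam).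
Proof.
move=> hT TC num lam Sp; apply/psd_toeplitz_pt => v; rewrite leNgt; apply/negP => neg.
apply: Sp; pose c := autocorr v; pose M := tuple_shift T lam.
have ME k x : tnth M k x = tnth T k x - tnth lam k *: x.
  by rewrite tnth_mktuple.
have bM k : bounded_op (tnth M k).
  suff -> : tnth M k = - tnth lam k *: idfun + tnth T k.
    by apply: bounded_op_comb; [exact: bounded_op_id|].
  by apply/funext => x; rewrite ME !op_E scaleNr addrC.
have MC : commuting M.
  move=> j k; apply/funext => x /=; rewrite !ME.
  have [lj _] := hT j; have [lk _] := hT k.
  rewrite (linear_opB _ _ lj) (linear_opB _ _ lk) (linear_opZ _ _ lj) (linear_opZ _ _ lk).
  rewrite -[tnth T j (tnth T k x)]/((tnth T j \o tnth T k) x) TC/=.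
  rewrite !scalerBr !scalerA (mulrC (tnth lam j)) !opprB !addrA.
  by rewrite [LHS]addrAC [RHS]addrAC; congr (_ + _); rewrite addrAC.
pose A : H -> H := \sum_k c k *: tnth M k.
have bA : bounded_op A by apply: bounded_op_sum => k; exact: bounded_opZ.
have AE x : A x = \sum_k c k *: tnth M k x by rewrite /A fct_sumE.
(* For a unit vector, the values of the form at the vector states and at [lam] share the energy term
   and differ by [2 * rdot (A xi) xi]. The former is nonnegative, so [rdot (A xi) xi >= e]. *)
pose e := - toeplitz_val a lam v / 2.
have e0 : 0 < e by rewrite divr_gt0// oppr_gt0.
have Ae x : e * nm x ^+ 2 <= rdot (A x) x.
  have [->|x0] := eqVneq x 0.
    by rewrite nm0 expr0n mulr0 /rdot hdot0r.
  have nx : 0 < nm x by rewrite nm_gt0.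
  pose xi := ((nm x)^-1)%:C *: x.
  have nxi : nm xi = 1.
    by rewrite /xi nmZ cabs_real ger0_norm ?invr_ge0 ?nm_ge0// mulVf// gt_eqF.
  have xE : x = (nm x)%:C *: xi.
    by rewrite /xi scalerA -rmorphM/= divff ?scale1r// gt_eqF.
  have he : e <= rdot (A xi) xi.
    have := num xi; rewrite normE nxi => /(_ erefl).
    rewrite toeplitz_vecE// => /psd_toeplitz_pt/(_ v).
    rewrite /e /toeplitz_val AE /rdot hdot_suml.
    have -> : \sum_k hdot (c k *: tnth M k xi) xi =
        \sum_k autocorr v k * tnth (vector_states T xi) k -
        \sum_k autocorr v k * tnth lam k.
      rewrite -sumrB; apply: eq_bigr => k _.
      rewrite ME hdotZl hdotDl hdotNl hdotZl hdot_diag nxi expr1n mulr1 tnth_map.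
      by rewrite mulrBr.
    by rewrite ReD ReN; lra.
  rewrite {2 3}xE (linear_opZ _ _ (proj1 bA)) (sformZl rdot_sform) (sformZr rdot_sform).
  by rewrite mulrA -expr2 mulrC ler_pM2l// exprn_gt0.
have [B bB [AB BA]] := coercive_inverse bA e0 Ae.
have lM k : linear (tnth M k) by case: (bM k).
apply: (koszul_exact_of_inverse lM MC (c := c) (B := B)); first by case: bB.
- move=> k x; rewrite -[RHS]BA; congr B; rewrite AE.
  rewrite -{1}(AB x) AE (linear_op_sum _ _ _ (lM k)); apply: eq_bigr => j _.
  by rewrite (linear_opZ _ _ (lM k)) -[tnth M k _]/((tnth M k \o tnth M j) _) MC.
- by move=> x; rewrite -[RHS]AB AE.
Qed.

End ToeplitzForms.

(** * Hermitian operator matrices *)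

Section OperatorMatrices.
Context {R : realType} {H : hilbertType R} {n : nat}.
Local Notation C := R[i].
Local Notation V := ('I_n -> H).
Implicit Types (X Y : V) (A : 'M[H -> H]_n).

Definition cdot X Y : C := \sum_i hdot (X i) (Y i).
Definition sdot X Y : R := \sum_i rdot (X i) (Y i).
Definition opmx_app A X : V := fun i => \sum_j A i j (X j).

Lemma Re_cdot X Y : Re (cdot X Y) = sdot X Y.
Proof. by rewrite /cdot Re_sum. Qed.

Lemma conj_cdot X Y : conjC (cdot X Y) = cdot Y X.
Proof. by rewrite rmorph_sum; apply: eq_bigr => i _; rewrite [RHS]hdotC. Qed.

Lemma sdot_sform : sform (sdot : V -> V -> R).
Proof.
split=> [X Y|X Y Z|r X Y|X]; rewrite /sdot.
- by apply: eq_bigr => i _; exact: rdotC.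
- by rewrite -big_split/=; apply: eq_bigr => i _; rewrite -(sformDl rdot_sform).
- by rewrite mulr_sumr; apply: eq_bigr => i _; rewrite -(sformZl rdot_sform).
- by apply: sumr_ge0 => i _; rewrite rdot_diag sqr_ge0.
Qed.

Lemma sdot_diag X : sdot X X = \sum_i nm (X i) ^+ 2.
Proof. by apply: eq_bigr => i _; rewrite rdot_diag. Qed.

Lemma nm_coord X i : nm (X i) ^+ 2 <= sdot X X.
Proof. by rewrite sdot_diag (bigD1 i)//= lerDl sumr_ge0// => k _; rewrite sqr_ge0. Qed.

Lemma finite_bound (I : finType) (B : I -> H -> H) :
  (forall i, bounded_op (B i)) ->
  exists2 M : R, 0 <= M & forall i x, nm (B i x) <= M * nm x.
Proof.
move=> bB; have ex i : exists M : R, 0 <= M /\ forall x, nm (B i x) <= M * nm x.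
  by have [M M0 hM] := bounded_opP (bB i); exists M.
have [M hM] := choice ex; exists (\sum_i M i).
  by apply: sumr_ge0 => i _; case: (hM i).
move=> i x; have [M0 Mx] := hM i; apply: le_trans (Mx x) _.
rewrite ler_wpM2r ?nm_ge0// (bigD1 i)//= lerDl sumr_ge0// => k _.
by case: (hM k).
Qed.

Lemma sum_sqr_le (I : finType) (u : I -> R) :
  (\sum_i u i) ^+ 2 <= #|I|%:R * \sum_i u i ^+ 2.
Proof.
have -> : (\sum_i u i) ^+ 2 = \sum_i \sum_j u i * u j.
  by rewrite expr2 mulr_suml; apply: eq_bigr => i _; rewrite mulr_sumr.
have : (\sum_i \sum_j u i * u j) * 2 <= \sum_i \sum_j (u i ^+ 2 + u j ^+ 2).
  rewrite mulr_suml; apply: ler_sum => i _; rewrite mulr_suml; apply: ler_sum => j _.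
  by have := sqr_ge0 (u i - u j); lra.
have -> : \sum_i \sum_j (u i ^+ 2 + u j ^+ 2) = 2 * (#|I|%:R * \sum_i u i ^+ 2).
  transitivity (\sum_i (#|I|%:R * u i ^+ 2 + \sum_j u j ^+ 2)).
    by apply: eq_bigr => i _; rewrite big_split/= sumr_const mulr_natl.
  by rewrite big_split/= -mulr_sumr sumr_const -[_ *+ _]mulr_natl; ring.
by rewrite mulrC ler_pM2l.
Qed.

Definition hermitian_opmx A :=
  (forall i j, bounded_op (A i j)) /\ forall i j, adj (A i j) = A j i.

Lemma cdot_hermitian A X Y : hermitian_opmx A ->
  cdot (opmx_app A X) Y = cdot X (opmx_app A Y).
Proof.
move=> [bA hA]; rewrite /cdot /opmx_app.
under eq_bigr do rewrite hdot_suml.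
under [RHS]eq_bigr do rewrite hdot_sumr.
rewrite [RHS]exchange_big/=; apply: eq_bigr => i _; apply: eq_bigr => j _.
by rewrite (adjP (bA i j)) hA.
Qed.

Lemma opmx_symmetric A : hermitian_opmx A -> symmetric_op sdot (opmx_app A).
Proof.
move=> hA; have [bA _] := hA.
split.
- split=> [X Y|r X]; apply/funext => i; rewrite /opmx_app.
    rewrite -[RHS]/(_ + _) -big_split; apply: eq_bigr => j _ /=.
    by rewrite -[(X + Y) j]/(X j + Y j) (linear_opD _ _ (proj1 (bA i j))).
  rewrite -[RHS]/(_ *: _) scaler_sumr; apply: eq_bigr => j _.
  by rewrite -[(_ *: X) j]/(_ *: X j) (linear_opZ _ _ (proj1 (bA i j))).
- by move=> X Y; rewrite -!Re_cdot cdot_hermitian.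
have [M M0 hM] :=
  @finite_bound _ (fun p : 'I_n * 'I_n => A p.1 p.2) (fun p => bA p.1 p.2).
exists (n%:R * (n%:R * M ^+ 2)).
  by rewrite !mulr_ge0// sqr_ge0.
move=> X; rewrite [leLHS]sdot_diag.
have -> : n%:R * (n%:R * M ^+ 2) * sdot X X = \sum_(i < n) (n%:R * (M ^+ 2 * sdot X X)).
  by rewrite sumr_const card_ord -mulr_natl; ring.
apply: ler_sum => i _.
have h1 : nm (opmx_app A X i) <= \sum_j M * nm (X j).
  by apply: le_trans (nm_sum _ _ _) _; apply: ler_sum => j _; exact: (hM (i, j)).
have h2 : nm (opmx_app A X i) ^+ 2 <= (\sum_j M * nm (X j)) ^+ 2.
  by rewrite ler_sqr ?nnegrE ?nm_ge0// sumr_ge0// => j _; rewrite mulr_ge0 ?nm_ge0.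
apply: le_trans h2 (le_trans (sum_sqr_le _) _).
rewrite card_ord ler_wpM2l// sdot_diag mulr_sumr.
by apply: ler_sum => j _; rewrite exprMn.
Qed.

(** Hermitian symmetry makes the complex value of the form equal to its conjugate, so the real form
    carries it all. *)
Lemma positive_opmxP A : hermitian_opmx A ->
  positive_opmx A <-> forall X, 0 <= sdot (opmx_app A X) X.
Proof.
move=> hA; have E X : cdot (opmx_app A X) X = (sdot (opmx_app A X) X)%:C.
  apply: complex_ext; rewrite ?Re_cdot//=.
  have : Im (conjC (cdot (opmx_app A X) X)) = Im (cdot (opmx_app A X) X).
    by rewrite conj_cdot -cdot_hermitian.
  by rewrite Im_conj; lra.
split=> h X; have := h X; rewrite -/(opmx_app A X).
  by rewrite -[X in 0 <= X]/(cdot (opmx_app A X) X) E ler0c.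
by rewrite -ler0c -E.
Qed.

Definition diag_op (f : H -> H) X : V := fun i => f (X i).

Lemma diag_op_symmetric (f : H -> H) : bounded_op f ->
  (forall x y, hdot (f x) y = hdot x (f y)) -> symmetric_op sdot (diag_op f).
Proof.
move=> bf sf; have [lf _] := bf; split.
- split=> [X Y|r X]; apply/funext => i; first exact: linear_opD.
  exact: linear_opZ.
- by move=> X Y; apply: eq_bigr => i _; rewrite /rdot sf.
have [M M0 hM] := bounded_opP bf; exists (M ^+ 2); first exact: sqr_ge0.
move=> X; rewrite !sdot_diag mulr_sumr; apply: ler_sum => i _.
by rewrite -exprMn ler_sqr ?nnegrE ?mulr_ge0 ?nm_ge0//; exact: hM.
Qed.

End OperatorMatrices.

(** * Positivity of T_alpha for large alpha *)

Section ToeplitzOperators.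
Context {R : realType} {H : hilbertType R} {d : nat}.
Implicit Types (T N : d.-tuple (H -> H)) (a : R).

Lemma toeplitz_tr (E : nmodType) (a : E) (low upp : d.-tuple E) i j :
  toeplitz a low upp j i = toeplitz a upp low i j.
Proof. by rewrite !mxE; case: ltngtP. Qed.

Lemma toeplitz_op_hermitian a T : (forall j, bounded_op (tnth T j)) ->
  hermitian_opmx (toeplitz_op a T).
Proof.
move=> hT; split=> i j; first exact: toeplitz_op_bounded.
rewrite /toeplitz_op [RHS]toeplitz_tr.
apply: (toeplitz_ind (P := fun A B => adj A = B)).
- rewrite -[X in adj X]addr0 adj_comb; [|exact: bounded_op_id|exact: bounded_op0].
  by rewrite adj_id adj0 addr0 conj_Creal// complex_real.
- by move=> k; rewrite tnth_map.
- by move=> k; rewrite tnth_map adjK.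
Qed.

(** Supplies nonemptiness of the sets whose infima are compared. Since [K] bounds the square of the
    norm of the off-diagonal part, that part is at least [- (K + 1) / 2], and [K + 1] on the
    diagonal compensates it. *)
Lemma positive_op_exists T : (forall j, bounded_op (tnth T j)) ->
  exists a : R, 0 <= a /\ positive_opmx (toeplitz_op a T).
Proof.
move=> hT; have h0 := toeplitz_op_hermitian 0 hT.
have [_ _ [K K0 hK]] := opmx_symmetric h0.
exists (K + 1); split; first by lra.
apply/(positive_opmxP (toeplitz_op_hermitian _ hT)) => X.
have -> : opmx_app (toeplitz_op (K + 1) T) X =
    (K + 1)%:C *: X + opmx_app (toeplitz_op 0 T) X.
  apply/funext => i; rewrite /opmx_app -[RHS]/((K + 1)%:C *: X i + _).
  have diagE a : toeplitz_op a T i i (X i) = a%:C *: X i by rewrite !mxE ltnn.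
  rewrite (bigD1 i)//= [in RHS](bigD1 i)//= addrA; congr (_ + _).
    by rewrite !diagE (_ : 0%:C = 0)// scale0r addr0.
  apply: eq_bigr => j ji; rewrite !mxE.
  by move: ji; rewrite -val_eqE/=; case: ltngtP.
rewrite (sformDl sdot_sform) (sformZl sdot_sform).
have := sform_amgm1N sdot_sform (opmx_app (toeplitz_op 0 T) X) X.
have := hK X; have := sform_ge0 sdot_sform X; nra.
Qed.

End ToeplitzOperators.

(** * The commuting symmetric family of a normal tuple *)

Section NormalTuples.
Context {R : realType} {H : hilbertType R} {d : nat}.
Local Notation C := R[i].
Local Notation V := ('I_d.+1 -> H).
Variable N : d.-tuple (H -> H).
Hypotheses (hN : forall j, bounded_op (tnth N j)) (NN : normal_tuple N).
Implicit Types (f g : H -> H) (x y : H) (X : V).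

Definition commuting_with_tuple g :=
  linear g /\ forall j x, g (tnth N j x) = tnth N j (g x) /\
                          g (adj (tnth N j) x) = adj (tnth N j) (g x).

Let hNs j : bounded_op (adj (tnth N j)). Proof. exact: adj_bounded. Qed.

Let fug j k x : adj (tnth N j) (tnth N k x) = tnth N k (adj (tnth N j) x).
Proof.
rewrite -[LHS]/((adj (tnth N j) \o tnth N k) x) fuglede//; first exact: (proj2 NN).
exact: (proj1 NN).
Qed.

Let commuting_gen j : commuting_with_tuple (tnth N j).
Proof.
split=> [|k x]; first by case: (hN j).
by rewrite fug -[LHS]/((tnth N j \o tnth N k) x) (proj1 NN).
Qed.

Let commuting_adj j : commuting_with_tuple (adj (tnth N j)).
Proof.
split=> [|k x]; first by case: (hNs j).
split; first exact: fug.
rewrite -[LHS]/((adj (tnth N j) \o adj (tnth N k)) x) -adj_comp//.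
by rewrite (proj1 NN) adj_comp.
Qed.

(** The family is indexed by all of [nat], so places beyond the tuple are read as the zero operator,
    which obeys the same commutation rules. *)
Lemma nth_tuple m : (exists j, N`_m = tnth N j) \/ N`_m = 0.
Proof.
have [md|dm] := ltnP m d; last by right; rewrite nth_default// size_tuple.
by left; exists (Ordinal md); rewrite (tnth_nth 0).
Qed.

Let bounded_nth m : bounded_op N`_m.
Proof. by have [[j ->]|->] := nth_tuple m; [exact: hN | exact: bounded_op0]. Qed.

(* Up to factors, the real ([k] odd) and imaginary ([k] even) parts of the
   operators of the tuple. *)
Definition parts_coef k : C := if odd k then 1 else 'i.
Definition parts k : H -> H :=
  parts_coef k *: N`_(k./2) + conjC (parts_coef k) *: adj N`_(k./2).

Lemma partsE k x :
  parts k x = parts_coef k *: N`_(k./2) x + conjC (parts_coef k) *: adj N`_(k./2) x.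
Proof. by []. Qed.

Lemma parts_bounded k : bounded_op (parts k).
Proof.
by apply: bounded_opD; apply: bounded_opZ; [|apply: adj_bounded]; exact: bounded_nth.
Qed.

Lemma parts_selfadjoint k x y : hdot (parts k x) y = hdot x (parts k y).
Proof.
rewrite !partsE hdotDl !hdotZl hdotDr !hdotZr conjCK addrC; congr (_ + _).
  by congr (_ * _); rewrite (adjP (adj_bounded (bounded_nth _))) adjK.
by rewrite adjP.
Qed.

Lemma commuting_parts g k x : commuting_with_tuple g -> g (parts k x) = parts k (g x).
Proof.
move=> [lg hg]; rewrite !partsE (linear_opD _ _ lg) !(linear_opZ _ _ lg).
have [[j ->]|->] := nth_tuple k./2.
  by have [-> ->] := hg j x.
by rewrite adj0 !op_E (linear_op0 lg).
Qed.

Lemma parts_commuting k : commuting_with_tuple (parts k).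
Proof.
split=> [|j x]; first by case: (parts_bounded k).
by split; rewrite -commuting_parts//.
Qed.

Variable a : R.

(** The Toeplitz operator has index 0 because [joint_approx_eigen] gives the bottom of the form at
    that index; the parts are shifted by one. *)
Definition toeplitz_family (k : nat) : V -> V :=
  if k is m.+1 then diag_op (parts m) else opmx_app (toeplitz_op a N).

Lemma toeplitz_family_symmetric k : symmetric_op sdot (toeplitz_family k).
Proof.
case: k => [|k] /=; first exact/opmx_symmetric/toeplitz_op_hermitian.
by apply: diag_op_symmetric; [exact: parts_bounded|exact: parts_selfadjoint].
Qed.

Lemma toeplitz_family_commute j k X :
  toeplitz_family j (toeplitz_family k X) = toeplitz_family k (toeplitz_family j X).
Proof.
have key m : opmx_app (toeplitz_op a N) (diag_op (parts m) X) =
             diag_op (parts m) (opmx_app (toeplitz_op a N) X).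
  apply/funext => i; rewrite /diag_op /opmx_app.
  have [lp hp] := parts_commuting m.
  rewrite (linear_op_sum _ _ _ lp); apply: eq_bigr => l _.
  apply: (toeplitz_ind (P := fun A (_ : C) => A (parts m (X l)) = parts m (A (X l)))
     (b := 0) (low' := [tuple 0 | _ < d]) (upp' := [tuple 0 | _ < d])).
  - by rewrite !opZ_E/= (linear_opZ _ _ lp).
  - by move=> k'; have [-> _] := hp k' (X l).
  - by move=> k'; rewrite tnth_map; have [_ ->] := hp k' (X l).
case: j => [|j]; case: k => [|k] //=.
by apply/funext => i; rewrite /diag_op commuting_parts//; exact: parts_commuting.
Qed.

Lemma approx_of_parts j x (p q t : R) :
    nm (parts j.*2.+1 x - p%:C *: x) <= t -> nm (parts j.*2 x - q%:C *: x) <= t ->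
    let mu := (p%:C - 'i * q%:C) / 2%:R in
  nm (N`_j x - mu *: x) <= t /\ nm (adj N`_j x - conjC mu *: x) <= t.
Proof.
move=> hp hq /=; set mu := _ / 2%:R.
have nz2 : (2%:R : C) != 0 by rewrite pnatr_eq0.
have ii : 'i * 'i = -1 :> C by rewrite -expr2 sqr_i.
have conji : conjC 'i = - 'i :> C.
  by apply: complex_ext; rewrite ?Re_conj ?Im_conj/= ?oppr0.
have muc : conjC mu = (p%:C + 'i * q%:C) / 2%:R.
  rewrite /mu rmorphM rmorphB rmorphM/= conji fmorphV rmorph_nat mulNr opprK.
  by rewrite !conj_Creal ?complex_real.
have oddE y : parts j.*2.+1 y = N`_j y + adj N`_j y.
  by rewrite partsE /parts_coef /= odd_double/= uphalf_double conjC1 !scale1r.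
have evenE y : parts j.*2 y = 'i *: N`_j y - 'i *: adj N`_j y.
  by rewrite partsE /parts_coef /= odd_double/= doubleK conji scaleNr.
have half (z : H) : nm (2%:R *: z) <= t + t -> nm z <= t.
  by rewrite nmZ cabs_nat; lra.
have nmi (z : H) : nm ('i *: z) = nm z.
  suff c1 : cabs 'i = 1 :> R by rewrite nmZ c1 mul1r.
  by apply/eqP; rewrite -(eqrXn2 (n:=2))// ?cabs_ge0// cabs_sqr/= expr0n add0r.
have e1 : 'i *: (parts j.*2 x - q%:C *: x) =
    - N`_j x + adj N`_j x - ('i * q%:C) *: x.
  by rewrite evenE !scalerBr !scalerA ii !scaleN1r opprK.
split; apply: half.
  have -> : 2%:R *: (N`_j x - mu *: x) =
      (parts j.*2.+1 x - p%:C *: x) - 'i *: (parts j.*2 x - q%:C *: x).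
    rewrite e1 oddE scalerBr scalerA /mu mulrC divfK// scalerBl scaler_nat mulr2n.
    rewrite !opprD !opprK !addrA; congr (_ + _); rewrite [RHS]addrAC.
    by rewrite (addrAC (N`_j x + adj N`_j x)) addrK [RHS]addrAC.
  by apply: le_trans (nmB _ _) _; rewrite nmi lerD.
have -> : 2%:R *: (adj N`_j x - conjC mu *: x) =
    (parts j.*2.+1 x - p%:C *: x) + 'i *: (parts j.*2 x - q%:C *: x).
  rewrite e1 oddE scalerBr scalerA muc mulrC divfK// scaler_nat mulr2n scalerDl.
  rewrite opprD !addrA; congr (_ - _).
  by rewrite (addrAC (N`_j x + adj N`_j x)) (addrC (N`_j x)) addrK [RHS]addrAC.
by apply: le_trans (nmD _ _) _; rewrite nmi lerD.
Qed.

End NormalTuples.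

(** * From the Gelfand spectrum back to T_alpha *)

Section GelfandToeplitz.
Context {R : realType} {H : hilbertType R} {d : nat}.
Local Notation C := R[i].
Local Notation V := ('I_d.+1 -> H).
Variables (N : d.-tuple (H -> H)) (a : R).
Hypotheses (hN : forall j, bounded_op (tnth N j)) (NN : normal_tuple N).

(** [r] is the norm of [X], to which all errors are relative. Some component [X i0] carries at least
    the average of the squares, so errors relative to [r] are also relative to [nm (X i0)]. *)
Lemma toeplitz_approx_eigen (X0 : V) :
    sdot (opmx_app (toeplitz_op a N) X0) X0 < 0 ->
  exists2 a0 : R, a0 < 0 & exists mu : d.-tuple C,
    forall h : R, 0 < h -> exists X : V, exists i0 : 'I_d.+1, exists r : R,
      [/\ 0 < nm (X i0), r <= d.+1%:R * nm (X i0), forall i, nm (X i) <= r,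
          forall i, nm (opmx_app (toeplitz_op a N) X i - a0%:C *: X i) <= h * r &
          forall i j, nm (tnth N j (X i) - tnth mu j *: X i) <= h * r /\
            nm (adj (tnth N j) (X i) - conjC (tnth mu j) *: X i) <= h * r].
Proof.
move=> neg; have sf := @sdot_sform R H d.+1.
have X00 : 0 < sdot X0 X0.
  rewrite lt_def sform_ge0// andbT; apply/eqP => s0.
  have := sform_cauchy sf (opmx_app (toeplitz_op a N) X0) X0.
  by rewrite s0 mulr0; nra.
have [b b0 bn] := joint_approx_eigen sf (toeplitz_family_symmetric hN a)
  (toeplitz_family_commute hN NN a) (ex_intro _ X0 X00) (d.*2).+1.
exists (b 0%N).
  by rewrite -(ltr_pM2r X00) mul0r; apply: le_lt_trans neg; exact: b0.
(* The parts [j.*2.+1] and [j.*2] have indices one higher in [toeplitz_family]. *)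
pose mu := [tuple ((b j.*2.+2)%:C - 'i * (b j.*2.+1)%:C) / 2%:R : C | j < d].
exists mu => h h0; have [|X sX hX] := bn (h ^+ 2); first by rewrite exprn_gt0.
pose r := Num.sqrt (sdot X X).
have r2 : r ^+ 2 = sdot X X by rewrite sqr_sqrtr// ltW.
have r0 : 0 <= r by exact: sqrtr_ge0.
have hr : 0 <= h * r by rewrite mulr_ge0// ltW.
have small k : (k < d.*2.+1)%N -> forall i,
    nm (toeplitz_family N a k X i - (b k)%:C *: X i) <= h * r.
  move=> kd i; apply: ler_of_sqr => //; rewrite exprMn r2.
  apply: le_trans hX.
  rewrite (bigD1 (Ordinal kd))//=.
  apply: le_trans (nm_coord (toeplitz_family N a k X - (b k)%:C *: X) i) _.
  by rewrite lerDl; apply: sumr_ge0 => l _; exact: sform_ge0.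
have [i0 hi0] : exists i0 : 'I_d.+1, sdot X X <= d.+1%:R * nm (X i0) ^+ 2.
  apply: contrapT => /forallNP no.
  have : \sum_(i < d.+1) d.+1%:R * nm (X i) ^+ 2 < \sum_(i < d.+1) sdot X X.
    apply: ltr_sum => [|i _]; last by rewrite ltNge; apply/negP/no.
    by apply/hasP; exists ord0 => //; rewrite mem_index_enum.
  by rewrite -mulr_sumr -sdot_diag sumr_const card_ord mulr_natl ltxx.
have d1 : (1 : R) <= d.+1%:R by rewrite ler1n.
have rX : r <= d.+1%:R * nm (X i0).
  apply: ler_of_sqr; first by rewrite mulr_ge0 ?nm_ge0.
  rewrite r2; apply: le_trans hi0 _; rewrite exprMn.
  by rewrite ler_wpM2r ?sqr_ge0// expr2 ler_peMr//; lra.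
exists X, i0, r; split=> //.
- rewrite lt_def nm_ge0 andbT; apply/eqP => x0.
  by move: hi0; rewrite x0 expr0n mulr0 leNgt sX.
- by move=> i; apply: ler_of_sqr => //; rewrite r2; exact: nm_coord.
- by move=> i; exact: (small 0%N).
move=> i j; rewrite !tnth_mktuple (tnth_nth 0); apply: approx_of_parts => //.
  by apply: (small j.*2.+2); rewrite ltnS -doubleS leq_double.
by apply: (small j.*2.+1); rewrite ltnS ltn_double.
Qed.

Lemma gelfand_sub_op :
    (forall lam, gelfand_spectrum N lam -> psdmx (toeplitz_pt a lam)) ->
  positive_opmx (toeplitz_op a N).
Proof.
move=> psd; apply/(positive_opmxP (toeplitz_op_hermitian a hN)) => X0.
rewrite leNgt; apply/negP => /toeplitz_approx_eigen[a0 a00 [mu approx]].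
pose D : R := d.+1%:R; have D1 : 1 <= D by rewrite ler1n.
have D0 : 0 < D by apply: lt_le_trans D1.
have /psd pmu : gelfand_spectrum N mu.
  apply: approx_gelfand => // e e0.
  have [|X [i0 [r [x0 rX _ _ hX]]]] := approx (e / D); first by rewrite divr_gt0.
  exists (X i0); first by rewrite -nm_gt0.
  have er : e / D * r <= e * nm (X i0).
    rewrite mulrAC ler_pdivrMr// -mulrA ler_wpM2l ?(ltW e0)//.
    by rewrite mulrC.
  move=> j; have [h1 h2] := hX i0 j.
  by split; [apply: le_trans h1 er|apply: le_trans h2 er].
(* [D] summands, an error [(D + 1) * (h * r)] in each, and [D ^+ 2] from
   [r ^+ 2 <= D ^+ 2 * nm y ^+ 2]. With [h] below, the total error is at most half of the negative
   main term. *)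
pose W := D * (D + 1) * D ^+ 2.
have W0 : 0 < W by rewrite !mulr_gt0//; lra.
pose h := - a0 / (2 * W).
have h0 : 0 < h by rewrite divr_gt0 ?oppr_gt0// mulr_gt0.
have [X [i0 [r [x0 rX Xr hT hX]]]] := approx h h0.
pose y := X i0; pose L := toeplitz_pt a mu.
have r0 : 0 <= r by exact: le_trans (nm_ge0 _) (Xr i0).
pose z i := \sum_j L i j *: X j.
have entry i j : nm (toeplitz_op a N i j (X j) - L i j *: X j) <= h * r.
  apply: (toeplitz_ind (P := fun A c => nm (A (X j) - c *: X j) <= h * r)).
  - by rewrite opZ_E/= subrr nm0 mulr_ge0// ltW.
  - by move=> k; case: (hX j k).
  - by move=> k; rewrite !tnth_map; case: (hX j k).
have zT i : nm (z i - a0%:C *: X i) <= (D + 1) * (h * r).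
  have -> : z i - a0%:C *: X i =
      (opmx_app (toeplitz_op a N) X i - a0%:C *: X i)
      - \sum_j (toeplitz_op a N i j (X j) - L i j *: X j).
    by rewrite sumrB opprB [RHS]addrC addrA subrK.
  apply: le_trans (nmB _ _) _; rewrite mulrDl mul1r [leRHS]addrC lerD//.
  apply: le_trans (nm_sum _ _ _) _.
  have -> : D * (h * r) = \sum_(j < d.+1) h * r.
    by rewrite sumr_const card_ord -mulr_natl.
  by apply: ler_sum => j _; exact: entry.
(* The functional [hdot _ y] maps [X] to a scalar vector. As [L] has scalar entries it commutes with
   this functional, so [v] is an approximate eigenvector of [L] with eigenvalue [a0]. *)
pose v : 'cV[C]_d.+1 := \col_i hdot (X i) y.
pose w i := hdot (X i) y.
have pos : 0 <= \sum_i Re (conjC (w i) * hdot (z i) y).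
  have := pmu v; rewrite quad_formE lecE => /andP[_]; rewrite Re_sum.
  congr (_ <= _); apply: eq_bigr => i _; congr Re.
  rewrite /z hdot_suml mulr_sumr; apply: eq_bigr => j _.
  by rewrite hdotZl !mxE -/L -mulrA; congr (_ * _); rewrite mulrC.
have wr i : cabs (w i) <= r * nm y.
  by apply: le_trans (hdot_le _ _) _; rewrite ler_wpM2r ?nm_ge0.
have term i : Re (conjC (w i) * hdot (z i) y) <=
    a0 * cabs (w i) ^+ 2 + r * nm y * ((D + 1) * (h * r) * nm y).
  have -> : hdot (z i) y = a0%:C * w i + hdot (z i - a0%:C *: X i) y.
    by rewrite hdotDl hdotNl hdotZl addrC subrK.
  rewrite mulrDr ReD; apply: lerD.
    by rewrite mulrCA (mulrC (conjC _)) mul_conj ReM/= mul0r subr0.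
  apply: le_trans (ler_norm _) (le_trans (Re_le_cabs _) _).
  rewrite cabsM cabs_conj; apply: ler_pM; rewrite ?cabs_ge0//.
  by apply: le_trans (hdot_le _ _) _; rewrite ler_wpM2r ?nm_ge0.
have y2 : 0 < nm y ^+ 2 by rewrite exprn_gt0.
have total : \sum_i Re (conjC (w i) * hdot (z i) y) <=
    a0 * nm y ^+ 4 + D * (r * nm y * ((D + 1) * (h * r) * nm y)).
  (* Since [a0 < 0], the main terms other than that of [i0] may be dropped; the one kept is
     [a0 * nm y ^+ 4]. *)
  apply: le_trans (ler_sum _ (fun i _ => term i)) _.
  rewrite big_split/= sumr_const card_ord -mulr_natl lerD2r -mulr_sumr.
  rewrite ler_wnM2l ?(ltW a00)// (bigD1 i0)//= /w -/y hdot_diag cabs_real.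
  rewrite ger0_norm ?sqr_ge0// -exprM lerDl.
  by apply: sumr_ge0 => i _; exact: sqr_ge0.
have rr : r ^+ 2 <= D ^+ 2 * nm y ^+ 2.
  by rewrite -exprMn ler_sqr ?nnegrE// mulr_ge0 ?nm_ge0// ltW.
have bound : D * (r * nm y * ((D + 1) * (h * r) * nm y)) <= W * h * nm y ^+ 4.
  have -> : D * (r * nm y * ((D + 1) * (h * r) * nm y)) =
      (D * (D + 1) * h * nm y ^+ 2) * r ^+ 2 by ring.
  have -> : W * h * nm y ^+ 4 =
      (D * (D + 1) * h * nm y ^+ 2) * (D ^+ 2 * nm y ^+ 2) by rewrite /W; ring.
  apply: ler_wpM2l => //; apply: mulr_ge0 (ltW y2); apply: mulr_ge0 (ltW h0).
  exact: mulr_ge0 (ltW D0) (addr_ge0 (ltW D0) ler01).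
have Wh : W * h = - a0 / 2 by rewrite /h; field; rewrite gt_eqF.
have y4 : 0 < nm y ^+ 4 by rewrite exprn_gt0.
have : 0 < - a0 / 2 * nm y ^+ 4 by rewrite mulr_gt0// divr_gt0// oppr_gt0.
move: pos total bound; rewrite Wh; lra.
Qed.

End GelfandToeplitz.

Theorem proposition4p10 (R : realType) (H : hilbertType R) (d : nat) :
  (forall T : d.-tuple (H -> H),
      (forall j, bounded_op (tnth T j)) -> commuting T ->
      toeplitz_spectral_radius T <= toeplitz_num_radius T /\
      toeplitz_num_radius T <= toeplitz_modulus T) /\
  (forall N : d.-tuple (H -> H),
      (forall j, bounded_op (tnth N j)) -> normal_tuple N ->
      [/\ gelfand_toeplitz_radius N = toeplitz_spectral_radius N,
          toeplitz_spectral_radius N = toeplitz_num_radius N &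
          toeplitz_num_radius N = toeplitz_modulus N]).
Proof.
have inf_le (S S' : set R) : S' !=set0 -> S' `<=` S -> (forall x, S x -> 0 <= x) ->
    inf S <= inf S'.
  move=> S'0 sub pos; apply: lb_le_inf => // x /sub Sx.
  by apply: ge_inf => //; exists 0.
have main (T : d.-tuple (H -> H)) : (forall j, bounded_op (tnth T j)) -> commuting T ->
    toeplitz_spectral_radius T <= toeplitz_num_radius T /\
    toeplitz_num_radius T <= toeplitz_modulus T.
  move=> hT TC; have [a0 [a00 pos0]] := positive_op_exists hT.
  split; apply: inf_le => [|a [a_ge0 ha]|a []//].
  - by exists a0; split=> //; exact: positive_op_num.
  - by split=> //; exact: num_sub_taylor.
  - by exists a0.
  - by split=> //; exact: positive_op_num.
split=> // N hN NN; have [rw wr] := main N hN (proj1 NN).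
have [a0 [a00 pos0]] := positive_op_exists hN.
have Gr : gelfand_toeplitz_radius N <= toeplitz_spectral_radius N.
  apply: inf_le => [|a [a_ge0 ha]|a []//].
    exists a0; split=> //; apply: num_sub_taylor (proj1 NN) _ => //.
    exact: positive_op_num.
  by split=> // lam /(gelfand_sub_taylor hN); exact: ha.
(* This inequality closes the cycle. Its nonemptiness condition is met by carrying [a0] through all
   the other inclusions. *)
have rG : toeplitz_modulus N <= gelfand_toeplitz_radius N.
  apply: inf_le => [|a [a_ge0 ha]|a []//]; last by split=> //; exact: gelfand_sub_op.
  exists a0; split=> // lam /(gelfand_sub_taylor hN).
  by apply: num_sub_taylor (proj1 NN) _ lam => //; exact: positive_op_num.
by split; apply/eqP; rewrite eq_le; apply/andP; split; lra.
Qed.
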